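(* Score-induced Birkhoff extensions can be computed in $O(n^5)$ time. That is, for $f:\mathcal P_n\to\mathbb R$ and an identifying score matrix $S\in\mathbb R^{n\times n}$, the $S$-induced Birkhoff extension $F_S:\mathcal D_n\to\mathbb R$ of $f$ can be computed in $O(n^5)$ time.
   Context: $\mathcal D_n$ is the set of $n\times n$ doubly stochastic matrices (non-negative entries, every row and column sums to $1$); $\mathcal P_n$ is the set of $n\times n$ permutation matrices. A score matrix is a matrix $S\in\mathbb R^{n\times n}$; the score of $P\in\mathcal P_n$ is $\langle S,P\rangle=\sum_{i,j}S(i,j)P(i,j)$. $S$ is identifying if it assigns a unique score to every permutation matrix; it then induces a total order $\{P_\ell\}_{\ell=1}^{n!}$ on $\mathcal P_n$ by score (highest score first). The $S$-induced Birkhoff decomposition of $A\in\mathcal D_n$ is $(\alpha_\ell,P_\ell)_{\ell=1}^{n!}$, with coefficients defined recursively for $\ell=1,\dots,n!$ by $$\alpha_\ell=\min_{i,j}\Big\{A(i,j)-\sum_{m=1}^{\ell-1}\alpha_mP_m(i,j)\ \Big|\ P_\ell(i,j)=1\Big\}.$$ The $S$-induced (score-induced) Birkhoff extension of $f$ is the function $F_S:\mathcal D_n\to\mathbb R$ given by $F_S(A)=\sum_{\ell:\,\alpha_\ell\ne0}\alpha_\ell f(P_\ell)$, where the $\alpha_\ell$ are the coefficients of the $S$-induced Birkhoff decomposition of $A$. *)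

(* Defs.v *)
From HB Require Import structures.
From mathcomp Require Import all_boot all_order all_algebra all_fingroup.
From mathcomp Require Import reals.

Set Implicit Arguments.
Unset Strict Implicit.
Unset Printing Implicit Defensive.

Import Order.TTheory GRing.Theory Num.Theory.
Local Open Scope ring_scope.

Section BirkhoffExtension.
Variables (R : realType) (n : nat).

Definition permMx := {P : 'M[R]_n | is_perm_mx P}.

Definition perm_to_permMx (s : 'S_n) : permMx :=
  exist (fun P => is_perm_mx P) (perm_mx s) (perm_mx_is_perm R s).

Definition doubly_stochastic (A : 'M[R]_n) : Prop :=
  [/\ forall i j, 0 <= A i j,
      forall i, \sum_j A i j = 1
    & forall j, \sum_i A i j = 1].

Definition score (S : 'M[R]_n) (P : permMx) : R :=
  \sum_i \sum_j S i j * val P i j.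

Definition identifying (S : 'M[R]_n) : Prop := injective (score S).

(* All permutation matrices, highest score first.  When S is identifying the
   scores are strictly decreasing along this sequence. *)
Definition ranking (S : 'M[R]_n) : seq permMx :=
  sort (fun P Q => score S Q <= score S P) [seq perm_to_permMx s | s : 'S_n].

(* P_l, counted from l = 0; only the indices l < n`! are meaningful. *)
Definition ranked (S : 'M[R]_n) (l : nat) : permMx :=
  nth (perm_to_permMx 1%g) (ranking S) l.

(* The minimum of a nonempty sequence (and 0 on the empty one, which arises
   below only for n = 0). *)
Definition seq_min (s : seq R) : R := \big[Num.min/head 0 s]_(x <- s) x.

(* The coefficients of P_0, ..., P_(l-1). *)
Fixpoint coefs (S A : 'M[R]_n) (l : nat) : seq R :=
  if l is l'.+1 then
    let a := coefs S A l' in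
    rcons a (seq_min
      [seq A ij.1 ij.2 - \sum_(m < l') a`_m * val (ranked S m) ij.1 ij.2
         | ij <- enum {: 'I_n * 'I_n} & val (ranked S l') ij.1 ij.2 == 1])
  else [::].

Definition coef (S A : 'M[R]_n) (l : nat) : R := (coefs S A l.+1)`_l.

Definition birkhoff_extension (f : permMx -> R) (S A : 'M[R]_n) : R :=
  \sum_(l < n`! | coef S A l != 0) coef S A l * f (ranked S l).

End BirkhoffExtension.

(* A real RAM.  The memory consists of arrays, named by natural numbers fixed
   in the program text and indexed by all of nat: some hold natural numbers
   (used for control and addressing), some hold real numbers.  Every node of an
   expression that is evaluated, and every command that is executed, costs one
   time unit.  There is no multiplication or division of natural numbers, no
   conversion between the two sorts and no real constant besides 0 and 1, so
   that neither large integers nor the digits of a real can be used to do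
   several operations in one step. *)

Inductive nexp : Type :=
| NConst of nat
| NGet of nat & nexp            (* array name, index *)
| NAdd of nexp & nexp
| NSub of nexp & nexp.          (* truncated subtraction *)

Inductive rexp : Type :=
| RZero
| ROne
| RGet of nat & nexp
| RAdd of rexp & rexp
| RSub of rexp & rexp
| RMul of rexp & rexp
| RDiv of rexp & rexp.          (* x / 0 = 0 *)

Inductive bexp : Type :=
| NLe of nexp & nexp
| RLe of rexp & rexp
| BNot of bexp
| BAnd of bexp & bexp.          (* both sides are evaluated *)

Inductive cmd : Type :=
| Skip
| NSet of nat & nexp & nexp     (* array name, index, value *)
| RSet of nat & nexp & rexp
| Ask of nat & nexp & nat       (* array name, index, queried array *)
| Seq of cmd & cmd
| If of bexp & cmd & cmd
| While of bexp & cmd.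

Fixpoint ncost (e : nexp) : nat :=
  match e with
  | NConst _ => 1
  | NGet _ e => (ncost e).+1
  | NAdd e1 e2 | NSub e1 e2 => (ncost e1 + ncost e2).+1
  end.

Fixpoint rcost (e : rexp) : nat :=
  match e with
  | RZero | ROne => 1
  | RGet _ e => (ncost e).+1
  | RAdd e1 e2 | RSub e1 e2 | RMul e1 e2 | RDiv e1 e2 =>
      (rcost e1 + rcost e2).+1
  end.

Fixpoint bcost (b : bexp) : nat :=
  match b with
  | NLe e1 e2 => (ncost e1 + ncost e2).+1
  | RLe e1 e2 => (rcost e1 + rcost e2).+1
  | BNot b => (bcost b).+1
  | BAnd b1 b2 => (bcost b1 + bcost b2).+1
  end.

Section Semantics.
Variable R : realType.

Record mem : Type := Mem {
  nmem : nat -> nat -> nat;     (* array name, index *)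
  rmem : nat -> nat -> R }.

Definition upd (T : Type) (h : nat -> nat -> T) (a i : nat) (v : T) :
    nat -> nat -> T :=
  fun b j => if (b == a) && (j == i) then v else h b j.

Fixpoint neval (m : mem) (e : nexp) : nat :=
  match e with
  | NConst k => k
  | NGet a e => nmem m a (neval m e)
  | NAdd e1 e2 => (neval m e1 + neval m e2)%N
  | NSub e1 e2 => (neval m e1 - neval m e2)%N
  end.

Fixpoint reval (m : mem) (e : rexp) : R :=
  match e with
  | RZero => 0
  | ROne => 1
  | RGet a e => rmem m a (neval m e)
  | RAdd e1 e2 => reval m e1 + reval m e2
  | RSub e1 e2 => reval m e1 - reval m e2
  | RMul e1 e2 => reval m e1 * reval m e2
  | RDiv e1 e2 => reval m e1 / reval m e2
  end.

Fixpoint beval (m : mem) (b : bexp) : bool :=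
  match b with
  | NLe e1 e2 => (neval m e1 <= neval m e2)%N
  | RLe e1 e2 => reval m e1 <= reval m e2
  | BNot b => ~~ beval m b
  | BAnd b1 b2 => beval m b1 && beval m b2
  end.

(* An oracle answers queries about the content of one real array. *)
Definition oracle := (nat -> R) -> option R.

(* exec o c m t m' : from memory m, the command c halts after t time units in
   memory m'.  The relation is deterministic; a query that the oracle rejects
   has no execution. *)
Inductive exec (o : oracle) : cmd -> mem -> nat -> mem -> Prop :=
| ESkip m : exec o Skip m 1 m
| ENSet a i e m :
    exec o (NSet a i e) m (ncost i + ncost e).+1
      (Mem (upd (nmem m) a (neval m i) (neval m e)) (rmem m))
| ERSet a i e m :
    exec o (RSet a i e) m (ncost i + rcost e).+1
      (Mem (nmem m) (upd (rmem m) a (neval m i) (reval m e)))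
| EAsk a i q m v :
    o (rmem m q) = Some v ->
    exec o (Ask a i q) m (ncost i).+1
      (Mem (nmem m) (upd (rmem m) a (neval m i) v))
| ESeq c1 c2 m1 m2 m3 t1 t2 :
    exec o c1 m1 t1 m2 -> exec o c2 m2 t2 m3 ->
    exec o (Seq c1 c2) m1 (t1 + t2).+1 m3
| EIf b c1 c2 m m' t :
    exec o (if beval m b then c1 else c2) m t m' ->
    exec o (If b c1 c2) m (bcost b + t).+1 m'
| EWhileStop b c m :
    beval m b = false -> exec o (While b c) m (bcost b).+1 m
| EWhileStep b c m1 m2 m3 t1 t2 :
    beval m1 b = true -> exec o c m1 t1 m2 -> exec o (While b c) m2 t2 m3 ->
    exec o (While b c) m1 (bcost b + t1 + t2).+1 m3.

(* The n x n matrix stored row by row in an array. *)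
Definition read_mx (n : nat) (h : nat -> R) : 'M[R]_n :=
  \matrix_(i, j) h (i * n + j)%N.

(* Access to f : permMx R n -> R.  The program has to write the permutation
   matrix entry by entry into an array before it can ask for its value. *)
Definition oracle_of (n : nat) (f : permMx R n -> R) : oracle :=
  fun h => omap f (insub (read_mx n h)).

(* On input n, S, A, given in cell 0 of natural array 0 and in real arrays 0
   and 1, with access to f, the program c halts within T time units, leaving r
   in cell 0 of real array 2.  The rest of the initial memory is arbitrary. *)
Definition computes_within (c : cmd) (n : nat) (f : permMx R n -> R)
    (S A : 'M[R]_n) (T : nat) (r : R) : Prop :=
  forall m : mem,
    nmem m 0 0 = n -> read_mx n (rmem m 0) = S -> read_mx n (rmem m 1) = A ->
    exists t m',
      [/\ exec (oracle_of f) c m t m', (t <= T)%N & rmem m' 2 0 = r].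

End Semantics.

(* Main.v *)
Require Import Defs.
From mathcomp Require Import all_boot all_order all_algebra all_fingroup.
From mathcomp Require Import reals.
From mathcomp Require Import zify ring lra.

(** The coefficient of a permutation is nonzero only if the current residual is
    positive along it, and then it is the highest-scored permutation supported
    by the residual: all earlier ones are blocked by a zero entry, and entries
    never increase.  So the decomposition is found by repeatedly computing a
    maximum-score permutation inside the support and subtracting it; each time
    at least one entry of the residual vanishes, whence at most n^2 rounds.
    A round is an assignment problem, solved in O(n^3) by the Hungarian method:
    rows are inserted one at a time, each by a shortest augmenting path grown
    column by column while dual potentials are kept feasible, and tight on
    matched pairs.  Entries outside the support get a cost so large that
    they are used only when no permutation is supported, in which case the
    minimum along the permutation found is 0 and the round has no effect. *)

Set Implicit Arguments.
Unset Strict Implicit.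
Unset Printing Implicit Defensive.

Import Order.TTheory GRing.Theory Num.Theory.
Local Open Scope ring_scope.

(* Ssreflect's [mem] and [Mem] shadow the memories of the machine. *)
Local Notation memory := Defs.mem.
Local Notation Memory := Defs.Mem.

(** The cubic bound rests on adding a column to the tree in time O(n). Minimal slacks are therefore
    never recomputed: the row of the newest column is compared once with the stored minima, and when
    the potentials move by [d] the stored minima move by [d] as well. A tree has at most [n] real
    columns, so an insertion costs O(n^2). No statement about shortest paths enters the invariants.
    Feasible potentials that are tight on a full matching certify its optimality by weak duality, so
    it is enough to preserve feasibility and tightness. *)

Lemma ltnS_eqVlt j k : (j < k.+1)%N = (j == k) || (j < k)%N.
Proof. by rewrite ltnS leq_eqVlt. Qed.

(** * Program logic *)

Section Logic.
Variables (R : realType) (o : oracle R).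
Implicit Types (m : memory R) (Q : memory R -> Prop) (c : cmd).

Definition wp c (T : nat) Q m :=
  exists t m', [/\ exec o c m t m', (t <= T)%N & Q m'].

Lemma wp_mono c T T' Q Q' m :
  (T <= T')%N -> (forall m', Q m' -> Q' m') -> wp c T Q m -> wp c T' Q' m.
Proof.
move=> leT sQ [t [m' [E le_t q]]]; exists t, m'.
by split=> //; [apply: leq_trans leT | apply: sQ].
Qed.

Lemma wp_post c T Q Q' m :
  wp c T Q m -> (forall m', Q m' -> Q' m') -> wp c T Q' m.
Proof. by move=> H sQ; apply: wp_mono (leqnn T) sQ H. Qed.

Lemma wp_seq T1 T2 T c1 c2 Q m :
  (T1 + T2 < T)%N -> wp c1 T1 (wp c2 T2 Q) m -> wp (Seq c1 c2) T Q m.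
Proof.
move=> ltT [t1 [m1 [E1 l1 [t2 [m2 [E2 l2 q]]]]]].
exists (t1 + t2).+1, m2; split=> //; first exact: ESeq E1 E2.
lia.
Qed.

Lemma wp_ask a i q T Q m v :
  o (rmem m q) = Some v -> ((ncost i).+1 <= T)%N ->
  Q (Memory (nmem m) (upd (rmem m) a (neval m i) v)) -> wp (Ask a i q) T Q m.
Proof. by move=> ov lT q'; do 2 eexists; split; [apply: EAsk ov | |]. Qed.

(** Code without loops and queries has a functional semantics, so its effect and a bound on its cost
    come from mere computation. [run] and [runcost] return dummy values on [Ask] and [While], which
    [straight] excludes. *)
Fixpoint straight c : bool :=
  match c with
  | Skip | NSet _ _ _ | RSet _ _ _ => true
  | Seq c1 c2 | If _ c1 c2 => straight c1 && straight c2
  | _ => false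
  end.

Fixpoint run c m : memory R :=
  match c with
  | NSet a i e => Memory (upd (nmem m) a (neval m i) (neval m e)) (rmem m)
  | RSet a i e => Memory (nmem m) (upd (rmem m) a (neval m i) (reval m e))
  | Seq c1 c2 => run c2 (run c1 m)
  | If b c1 c2 => if beval m b then run c1 m else run c2 m
  | _ => m
  end.

Fixpoint runcost c : nat :=
  match c with
  | NSet _ i e => (ncost i + ncost e).+1
  | RSet _ i e => (ncost i + rcost e).+1
  | Seq c1 c2 => (runcost c1 + runcost c2).+1
  | If b c1 c2 => (bcost b + maxn (runcost c1) (runcost c2)).+1
  | _ => 1
  end.

Lemma run_if b c1 c2 m :
  run (If b c1 c2) m = if beval m b then run c1 m else run c2 m.
Proof. by []. Qed.

Lemma wp_straight c T Q m :
  straight c -> (runcost c <= T)%N -> Q (run c m) -> wp c T Q m.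
Proof.
move=> sc le_T q.
suff [t E le_t] : exists2 t, exec o c m t (run c m) & (t <= runcost c)%N.
  by exists t, (run c m); split=> //; apply: leq_trans le_T.
elim: c sc m {le_T q} => //=.
- by move=> _ m; exists 1%N => //; apply: ESkip.
- by move=> a i e _ m; eexists; [apply: ENSet|].
- by move=> a i e _ m; eexists; [apply: ERSet|].
- move=> c1 IH1 c2 IH2 /andP[/IH1 {}IH1 /IH2 {}IH2] m.
  have [t1 E1 l1] := IH1 m; have [t2 E2 l2] := IH2 (run c1 m).
  by exists (t1 + t2).+1; [apply: ESeq E1 E2 | rewrite ltnS leq_add].
- move=> b c1 IH1 c2 IH2 /andP[/IH1 {}IH1 /IH2 {}IH2] m.
  have [t1 E1 l1] := IH1 m; have [t2 E2 l2] := IH2 m.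
  case Eb: (beval m b).
    exists (bcost b + t1).+1; last by rewrite ltnS leq_add2l leq_max l1.
    by apply: EIf; rewrite Eb.
  exists (bcost b + t2).+1; last by rewrite ltnS leq_add2l leq_max l2 orbT.
  by apply: EIf; rewrite Eb.
Qed.

(** The index of the invariant is a variant: it drops at every iteration, so its initial value also
    bounds their number. Termination and running time thus follow from one induction. *)
Lemma wp_while (I : nat -> memory R -> Prop) k T T' b c Q m :
  (k * (bcost b + T).+1 + (bcost b).+1 <= T')%N ->
  I k m ->
  (forall k m, I k m -> beval m b = false -> Q m) ->
  (forall k m, I k m -> beval m b = true ->
     wp c T (fun m' => exists2 k', (k' < k)%N & I k' m') m) ->
  wp (While b c) T' Q m.
Proof.
move=> leT' Ik stop step; apply: (wp_mono leT' (fun _ q => q)) => {leT'}.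
elim/ltn_ind: k m Ik => k IH m Ik.
case Eb: (beval m b); last first.
  exists (bcost b).+1, m; split; [exact: EWhileStop | lia | exact: stop Ik Eb].
have [t1 [m1 [E1 l1 [k' ltk' Ik']]]] := step _ _ Ik Eb.
have [t2 [m2 [E2 l2 q]]] := IH _ ltk' _ Ik'.
exists (bcost b + t1 + t2).+1, m2; split=> //; first exact: EWhileStep E1 E2.
suff: (k' * (bcost b + T).+1 + (bcost b + T).+1 <= k * (bcost b + T).+1)%N by lia.
by rewrite -mulSnr leq_mul2r ltk' orbT.
Qed.

Definition For (x : nat) (b : nexp) (c : cmd) : cmd :=
  Seq (NSet x (NConst 0) (NConst 0))
    (While (NLe (NAdd (NGet x (NConst 0)) (NConst 1)) b)
      (Seq c (NSet x (NConst 0) (NAdd (NGet x (NConst 0)) (NConst 1))))).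

Definition setx (x k : nat) m : memory R := Memory (upd (nmem m) x 0%N k) (rmem m).

(** The bound [b] is evaluated anew at every test, so the invariant has to determine its value. The
    increment is factored out of the body, which must leave the counter as it found it. *)
Lemma wp_for (I : nat -> memory R -> Prop) N T T' x b c Q m :
  (N * (T + ncost b + 20) + (ncost b + 20) <= T')%N ->
  (forall k m', I k m' -> neval m' b = N /\ nmem m' x 0 = k) ->
  I 0%N (setx x 0 m) ->
  (forall k m', (k < N)%N -> I k m' ->
     wp c T (fun m2 => nmem m2 x 0 = k /\ I k.+1 (setx x k.+1 m2)) m') ->
  (forall m', I N m' -> Q m') ->
  wp (For x b c) T' Q m.
Proof.
move=> leT' HI I0 step IQ.
apply: (wp_mono leT' IQ).
apply: (@wp_mono _ (3 + (N * ((5 + ncost b) + (T + 7).+1).+1 + (6 + ncost b))).+1 _ (I N)) => //.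
  nia.
rewrite /For; apply: (wp_seq (leqnn _)); apply: wp_straight => //.
(* The variant is the number [d] of remaining iterations, so the counter stands at [N - d]. *)
pose J d m' := (d <= N)%N /\ I (N - d)%N m'.
apply: (@wp_while J N (T + 7).+1).
- rewrite /=; nia.
- by rewrite /J subnn.
- move=> d m' [led Id] /=.
  have [-> ->] := HI _ _ Id.
  have [d0|d0] := posnP d; first by move: Id; rewrite d0 subn0.
  by lia.
- move=> d m' [led Id] /=.
  have [-> Ex] := HI _ _ Id; rewrite Ex => ltN.
  apply: (wp_seq (leqnn _)); apply: wp_mono (step _ _ _ Id); try lia.
  move=> m2 [Ex2 I2]; apply: wp_straight => //=.
  exists d.-1; first by lia.
  split; first by lia.
  have -> : (N - d.-1 = (N - d).+1)%N by lia.
  by move: I2; rewrite /setx Ex2 addn1.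
Qed.

Definition frame (ns rs : seq nat) m m' : Prop :=
  (forall a, a \notin ns -> nmem m' a = nmem m a) /\
  (forall a, a \notin rs -> rmem m' a = rmem m a).

Lemma frame_trans ns rs m1 m2 m3 :
  frame ns rs m1 m2 -> frame ns rs m2 m3 -> frame ns rs m1 m3.
Proof.
by move=> [n1 r1] [n2 r2]; split=> a Ha; rewrite (n2, r2) // (n1, r1).
Qed.

Lemma frame_sub ns rs ns' rs' m m' :
  all (mem ns') ns -> all (mem rs') rs ->
  frame ns rs m m' -> frame ns' rs' m m'.
Proof.
move=> /allP sn /allP sr [n1 r1].
by split=> a Ha; [apply: n1; apply: contra Ha => /sn | apply: r1; apply: contra Ha => /sr].
Qed.

Lemma frame_updn ns rs m h g a i v :
  a \in ns -> frame ns rs m (Memory h g) -> frame ns rs m (Memory (upd h a i v) g).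
Proof.
move=> an [n1 r1]; split=> // b Hb /=; rewrite -n1 // /upd.
by have /negPf -> // : b != a by apply: contra Hb => /eqP->.
Qed.

Lemma frame_updr ns rs m h g a i v :
  a \in rs -> frame ns rs m (Memory h g) -> frame ns rs m (Memory h (upd g a i v)).
Proof.
move=> an [n1 r1]; split=> // b Hb /=; rewrite -r1 // /upd.
by have /negPf -> // : b != a by apply: contra Hb => /eqP->.
Qed.

End Logic.

Ltac frame_upd := rewrite /setx /=;
  repeat (first [apply: frame_updn; [by [] |] | apply: frame_updr; [by [] |]]);
  rewrite /=; try assumption.

Ltac mem_simpl := unfold setx, upd; rewrite /=.

(** * The Hungarian method *)

Section Hungarian.
Variables (R : realType) (n : nat) (c : nat -> nat -> R).
Implicit Types (u v mv : nat -> R) (p st wy : nat -> nat).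

Definition setf (T : Type) (f : nat -> T) (x : nat) (y : T) : nat -> T :=
  fun z => if z == x then y else f z.

Definition slack u v r j : R := c r j - u r - v j.

Definition dual_feasible u v :=
  forall r j, (r < n)%N -> (j < n)%N -> 0 <= slack u v r j.

(* [p j] is the row matched to the column [j], and [n] if there is none.
   Column [n] is virtual: it holds the row that is being inserted.  Exactly the
   rows below [i] are matched, and column [h], the hole, is ignored. *)
Record matching (i h : nat) u v p : Prop := Matching {
  m_range : forall j, (j <= n)%N -> j != h -> (p j < i)%N \/ p j = n;
  m_inj : forall j k, (j <= n)%N -> (k <= n)%N -> j != h -> k != h ->
            p j = p k -> (p j < n)%N -> j = k;
  m_cover : forall r, (r < i)%N -> exists j, [/\ (j <= n)%N, j != h & p j = r];
  m_tight : forall j, (j < n)%N -> j != h -> (p j < n)%N ->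
            slack u v (p j) j = 0 }.

(** Two values of the hole are conventional. Hole [n] is the state between insertions, where the
    virtual column is disregarded; hole [n.+1] is out of range, so every column counts, including
    the virtual one with the new row. *)
Lemma matching_insert i u v p :
  (i < n)%N -> matching i n u v p -> matching i.+1 n.+1 u v (setf p n i).
Proof.
move=> lti [mr mi mc mt]; split; rewrite /setf.
- move=> j lej _; case: eqP => [_|/eqP njn]; first by left.
  by case: (mr j lej njn); [left; lia | right].
- move=> j k lej lek _ _.
  case: eqP => [->|/eqP nj]; case: eqP => [->|/eqP nk] //; last exact: mi.
    by move=> Ei; case: (mr k lek nk); lia.
  by move=> Ei; case: (mr j lej nj); lia.
- move=> r; rewrite ltnS leq_eqVlt => /predU1P[->|ltr].
    by exists n; rewrite eqxx leqnn; split=> //; lia.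
  have [j [lej nj pj]] := mc r ltr.
  by exists j; rewrite (negPf nj); split=> //; lia.
- move=> j ltj _; have nj : j != n by lia.
  by rewrite (negPf nj); apply: mt.
Qed.

(** A column without a row can be declared the hole because disregarding it uncovers no row. *)
Lemma matching_hole i h u v p :
  (i <= n)%N -> matching i n.+1 u v p -> p h = n -> matching i h u v p.
Proof.
have nn j : (j <= n)%N -> j != n.+1 by lia.
move=> lei [mr mi mc mt] ph; split.
- by move=> j lej _; apply: mr; rewrite ?nn.
- by move=> j k lej lek _ _; apply: mi; rewrite ?nn.
- move=> r ltr; have [j [lej _ pj]] := mc r ltr.
  exists j; split=> //; apply/eqP => jh; move: ph; rewrite -jh; lia.
- by move=> j ltj _; apply: mt; rewrite ?nn // ltnW.
Qed.

(** Flips one edge of the augmenting path: the row of [g] moves into the hole along a tight edge,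
    and [g] becomes the hole. *)
Lemma matching_shift i h g u v p :
  matching i h u v p -> (h < n)%N -> (g <= n)%N -> g != h ->
  slack u v (p g) h = 0 -> matching i g u v (setf p h (p g)).
Proof.
move=> [mr mi mc mt] lth leg ngh sl; split; rewrite /setf.
- by move=> j lej njg; case: eqP => [_|/eqP]; [apply: mr | apply: mr].
- move=> j k lej lek njg nkg.
  case: eqP => [->|/eqP nj]; case: eqP => [->|/eqP nk] //; last exact: mi.
    move=> e lt; have := mi g k leg lek ngh nk e lt; move/eqP: nkg; lia.
  move=> e lt; have := mi j g lej leg nj ngh e lt; move/eqP: njg; lia.
- move=> r /mc[j [lej njh pj]]; have [ejg|njg] := eqVneq j g.
    by exists h; rewrite eqxx -ejg pj; split=> //; [lia | rewrite ejg eq_sym].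
  by exists j; rewrite (negPf njh).
- by move=> j ltj njg; case: eqP => [->|/eqP nj] //; apply: mt.
Qed.

Definition usedrow p st k r : bool :=
  has (fun j => (0 < st j)%N && (p j == r)) (iota 0 k).

(** Column [x] is the one whose row may not have been compared with the minima yet; [n.+1], being
    out of range, exempts no column. *)
Definition folded x u v p st wy mv : Prop :=
  forall j, (j < n)%N -> st j = 0%N ->
    [/\ (wy j <= n)%N, (0 < st (wy j))%N, mv j = slack u v (p (wy j)) j &
        forall k, (k <= n)%N -> (0 < st k)%N -> k != x ->
          mv j <= slack u v (p k) j].

(* The alternating tree grown from row [i].  [st j] is the time at which column
   [j] entered the tree (0 if it has not), [wy] is the parent function and [j0]
   the newest column, not yet taken into account in the minimal slacks [mv]. *)
Record grow i k j0 u v p st wy mv : Prop := Grow {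
  g_match : matching i.+1 n.+1 u v p;
  g_feas : dual_feasible u v;
  g_root : p n = i;
  g_pos : (0 < k)%N;
  g_st0 : (0 < st n)%N;
  g_last : (j0 <= n)%N /\ st j0 = k;
  g_le : forall j, (j <= n)%N -> (st j <= k)%N;
  g_count : count (fun j => (0 < st j)%N) (iota 0 n) = k.-1;
  g_used : forall j, (j < n)%N -> (0 < st j)%N -> j != j0 -> (p j < n)%N;
  g_tree : forall j, (j < n)%N -> (0 < st j)%N ->
    [/\ (wy j <= n)%N, (0 < st (wy j) < st j)%N
      & slack u v (p (wy j)) j = 0];
  g_min : (1 < k)%N -> folded j0 u v p st wy mv }.

Lemma grow_init i u v p st wy mv :
  (i < n)%N -> matching i n u v p -> dual_feasible u v ->
  (forall j, (j < n)%N -> st j = 0%N) -> st n = 1%N ->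
  grow i 1 n u v (setf p n i) st wy mv.
Proof.
move=> lti mp fe s0 s1; split=> //.
- exact: matching_insert.
- by rewrite /setf eqxx.
- by rewrite s1.
- by move=> j; rewrite leq_eqVlt => /predU1P[->|/s0->//]; rewrite s1.
- rewrite /= (@eq_in_count _ _ pred0) ?count_pred0 // => j.
  by rewrite mem_iota => /= /s0 ->.
- by move=> j /s0 ->.
- by move=> j /s0 ->.
Qed.

Lemma grow_row_lt i k j0 u v p st wy mv j :
  grow i k j0 u v p st wy mv -> (i < n)%N -> (p j0 < n)%N ->
  (j <= n)%N -> (0 < st j)%N -> (p j < n)%N.
Proof.
move=> g lti p0; rewrite leq_eqVlt => /predU1P[->|ltj]; first by rewrite (g_root g).
by have [->//|nj] := eqVneq j j0; move/(g_used g); apply.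
Qed.

(** Pigeonhole: if the tree contained all columns, the [n.+1] columns, virtual one included, would
    hold distinct rows among the first [i.+1 <= n]. *)
Lemma grow_unused i k j0 u v p st wy mv :
  grow i k j0 u v p st wy mv -> (i < n)%N -> (p j0 < n)%N ->
  exists2 j, (j < n)%N & st j = 0%N.
Proof.
move=> g lti p0.
have [/hasP[j]|/hasPn H] := boolP (has (fun j => st j == 0%N) (iota 0 n)).
  by rewrite mem_iota => /= ltj /eqP; exists j.
have pn j : (j <= n)%N -> (p j < n)%N.
  move=> lej; apply: (grow_row_lt g lti p0 lej).
  move: lej; rewrite leq_eqVlt => /predU1P[->|ltj]; first exact: g_st0 g.
  by rewrite lt0n; apply: H; rewrite mem_iota.
have U : uniq (map p (iota 0 n.+1)).
  rewrite map_inj_in_uniq ?iota_uniq // => x y; rewrite !mem_iota /= !ltnS => lx ly.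
  by move=> e; apply: (m_inj (g_match g)) => //; rewrite ?pn //; lia.
have /(uniq_leq_size U) : {subset map p (iota 0 n.+1) <= iota 0 i.+1}.
  move=> r /mapP[x]; rewrite !mem_iota !add0n !ltnS => lex ->.
  by case: (m_range (g_match g) lex) => //; [lia | have := pn _ lex; lia].
by rewrite size_map !size_iota; lia.
Qed.

Lemma grow_fold i k j0 u v p st wy mv wy' mv' :
  grow i k j0 u v p st wy mv ->
  (forall j, (j < n)%N ->
     if [&& st j == 0 & (k <= 1) || (slack u v (p j0) j <= mv j)%R]%N
     then wy' j = j0 /\ mv' j = slack u v (p j0) j
     else wy' j = wy j /\ mv' j = mv j) ->
  grow i k j0 u v p st wy' mv' /\ folded n.+1 u v p st wy' mv'.
Proof.
move=> g H; have [lj0 sj0] := g_last g; have k0 := g_pos g.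
have st0 : (0 < st j0)%N by rewrite sj0.
have F : folded n.+1 u v p st wy' mv'.
  move=> j ltj sj; move: (H j ltj); rewrite sj eqxx /=.
  have [lek1|ltk1] := leqP k 1.
    move=> /= [-> ->]; split=> //.
    move=> l lel stl _; have [->//|nl] := eqVneq l j0.
    (* At time 1 the tree is the virtual column alone: a real column would have a parent that
       entered at an earlier, still positive time. Hence both [l] and [j0] are [n]. *)
    have [ltl|] := ltnP l n.
      have [_ /andP[s1 s2] _] := g_tree g ltl stl.
      by have := g_le g lel; lia.
    move=> gel; have El : l = n by lia.
    have [lt0|] := ltnP j0 n; last by move/eqP: nl; lia.
    have [_ /andP[s1 s2] _] := g_tree g lt0 st0.
    lia.
  have [wn sw -> M] := g_min g ltk1 ltj sj.
  case: ifP => /= [le [-> ->]|/negbT nle [-> ->]].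
    split=> //.
    move=> l lel stl _; have [->//|nl] := eqVneq l j0.
    by apply: le_trans (M l lel stl nl).
  split=> // l lel stl _; have [->|nl] := eqVneq l j0; last exact: M.
  by rewrite ltW // ltNge.
split=> //; case: g => *; split=> //.
  move=> j ltj sj; move: (H j ltj); rewrite eqn0Ngt sj /= => -[-> _].
  by move: ltj sj; auto.
by move=> _ j ltj sj; have [? ? ? M] := F j ltj sj; split=> // l ? ? _; apply: M => //; lia.
Qed.

(** The dual update leaves slacks between tree rows and tree columns unchanged, lowers those between
    tree rows and outside columns by [d], and raises those between outside rows and tree columns by
    [d]. Since [d] is the least slack leaving the tree, feasibility survives and the edge from the
    parent of [j1] becomes tight, so [j1] may enter. *)
Lemma grow_step i k j0 j1 d u v p st wy mv u' v' mv' :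
  grow i k j0 u v p st wy mv -> folded n.+1 u v p st wy mv ->
  (i < n)%N -> (p j0 < n)%N -> (j1 < n)%N -> st j1 = 0%N -> d = mv j1 ->
  (forall j, (j < n)%N -> st j = 0%N -> mv j1 <= mv j) ->
  (forall r, u' r = u r + if usedrow p st n.+1 r then d else 0) ->
  (forall j, (j < n)%N -> v' j = v j - if (0 < st j)%N then d else 0) ->
  (forall j, (j < n)%N -> st j = 0%N -> mv' j = mv j - d) ->
  grow i k.+1 j1 u' v' p (setf st j1 k.+1) wy mv'.
Proof.
move=> g F lti p0 ltj1 sj1 -> jmin Hu Hv Hm; set d' := mv j1 in jmin Hu Hv Hm *.
have rowlt := grow_row_lt g lti p0.
have d0 : 0 <= d'.
  have [wn sw e _] := F _ ltj1 sj1; rewrite /d' e; apply: (g_feas g) => //.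
  exact: rowlt.
have ur j : (j <= n)%N -> (0 < st j)%N -> usedrow p st n.+1 (p j).
  by move=> lej sj; apply/hasP; exists j; rewrite ?mem_iota ?sj ?eqxx.
have urP r : usedrow p st n.+1 r -> exists j, [/\ (j <= n)%N, (0 < st j)%N & p j = r].
  by case/hasP=> j; rewrite mem_iota /= ltnS => lej /andP[sj /eqP]; exists j.
have sl r j : (j < n)%N -> slack u' v' r j = slack u v r j -
   (if usedrow p st n.+1 r then d' else 0) + (if (0 < st j)%N then d' else 0).
  by move=> ltj; rewrite /slack Hu Hv //; ring.
have n1 j : (j <= n)%N -> j != n.+1 by lia.
have slused j l : (l < n)%N -> (j <= n)%N -> (0 < st j)%N ->
    slack u' v' (p j) l = slack u v (p j) l - if (0 < st l)%N then 0 else d'.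
  by move=> ltl lej sj; rewrite sl // ur //; case: ifP => _; ring.
(* By injectivity of [p], a matched row is in the tree exactly when its column is, so the two
   potential changes cancel on matched pairs. *)
have mS j : (j < n)%N -> (p j < n)%N -> slack u' v' (p j) j = slack u v (p j) j.
  move=> ltj pj; have [sj|] := posnP (st j); last first.
    by move=> sj; rewrite slused ?sj ?subr0 // ltnW.
  rewrite sl // sj /= addr0; case: ifP => [/urP[l [lel sl' e]]|]; last by rewrite subr0.
  have := m_inj (g_match g) lel (ltnW ltj) (n1 _ lel) (n1 _ (ltnW ltj)) e.
  by rewrite e => /(_ pj) El; move: sl'; rewrite El sj.
have ltnj1 : (n == j1) = false by lia.
have stj j : j != j1 -> setf st j1 k.+1 j = st j by rewrite /setf => /negPf->.
have stw j : (0 < st j)%N -> setf st j1 k.+1 j = st j.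
  by move=> sj; apply: stj; apply/eqP => e; move: sj; rewrite e sj1.
split.
- case: (g_match g) => mr mi mc mt; split=> // j ltj nj pj.
  by rewrite mS // mt.
- move=> r j ltr ltj; have [sj|sj] := posnP (st j); rewrite sl // ?sj /=.
    rewrite addr0; case: ifP => [/urP[l [lel sl' <-]]|_].
      rewrite subr_ge0; apply: le_trans (jmin j ltj sj) _.
      by have [_ _ _ M] := F j ltj sj; apply: M; rewrite ?n1.
    by rewrite subr0; apply: (g_feas g).
  have := g_feas g ltr ltj; case: ifP => _; lra.
- exact: g_root g.
- by [].
- by rewrite stw; apply: g_st0 g.
- by rewrite /setf eqxx ltnW.
- by move=> j lej; rewrite /setf; case: ifP => // _; apply: leqW; apply: g_le g _ lej.
- have cnt : count (predI (pred1 j1) (fun j => 0 < st j)%N) (iota 0 n) = 0%N.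
    rewrite (@eq_count _ _ pred0) ?count_pred0 // => j /=.
    by case: eqP => // ->; rewrite sj1.
  rewrite (@eq_count _ _ (predU (pred1 j1) (fun j => 0 < st j)%N)); last first.
    by move=> j /=; rewrite /setf; case: eqP.
  have := count_predUI (pred1 j1) (fun j => 0 < st j)%N (iota 0 n).
  rewrite cnt addn0 => ->; rewrite count_uniq_mem ?iota_uniq //.
  by rewrite mem_iota /= ltj1 (g_count g) add1n prednK ?(g_pos g).
- move=> j ltj; have [->|nj] := eqVneq j j1 => //.
  by rewrite stj // => sj _; apply: rowlt; rewrite // ltnW.
- move=> j ltj; have [->|nj] := eqVneq j j1.
    move=> _; have [wn sw e _] := F _ ltj1 sj1; split=> //.
      by rewrite stw // sw /setf eqxx ltnS; apply: g_le g _ wn.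
    by rewrite slused // sj1 /= -e /d' subrr.
  rewrite stj // => sj; have [wn /andP[s1 s2] e] := g_tree g ltj sj; split=> //.
    by rewrite stw // s1.
  by rewrite slused // sj subr0.
- move=> _ j ltj; have [->|nj] := eqVneq j j1; first by rewrite /setf eqxx.
  rewrite stj // => sj; have [wn sw e M] := F _ ltj sj; split=> //.
  + by rewrite stw.
  + by rewrite slused // sj -e Hm.
  + move=> l lel; have [->|nl] := eqVneq l j1 => //.
    rewrite stj // => sl' _; rewrite slused // sj Hm // lerD2r.
    by apply: M; rewrite ?n1.
Qed.

Lemma grow_bound i k j0 u v p st wy mv :
  grow i k j0 u v p st wy mv -> (k <= n.+1)%N.
Proof.
move=> g; have := count_size (fun j => 0 < st j)%N (iota 0 n).
by rewrite (g_count g) size_iota; lia.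
Qed.

(** The hole travels from the free column to the root. Tree edges are only claimed tight for columns
    that entered no later than the hole: their parents entered strictly earlier, and the columns
    whose row has already changed all entered after the hole. *)
Record augment i h u v p st wy : Prop := Augment {
  a_match : matching i h u v p;
  a_hole : (h <= n)%N /\ (0 < st h)%N;
  a_tree : forall j, (j < n)%N -> (0 < st j <= st h)%N ->
    [/\ (wy j <= n)%N, (0 < st (wy j) < st j)%N
      & slack u v (p (wy j)) j = 0] }.

Lemma augment_init i k h u v p st wy mv :
  (i < n)%N -> grow i k h u v p st wy mv -> p h = n -> augment i.+1 h u v p st wy.
Proof.
move=> lti g ph; have [leh sh] := g_last g; split.
- by apply: matching_hole => //; apply: g_match g.
- by rewrite sh (g_pos g).
- by move=> j ltj /andP[sj _]; apply: g_tree g _ ltj sj.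
Qed.

Lemma augment_step i h u v p st wy :
  augment i h u v p st wy -> (h < n)%N ->
  augment i (wy h) u v (setf p h (p (wy h))) st wy /\ (st (wy h) < st h)%N.
Proof.
move=> [mp [leh sh] tr] lth; have [|wn /andP[s1 s2] e] := tr h lth; first by rewrite sh leqnn.
split=> //; split=> //.
  by apply: matching_shift => //; apply/eqP => E; move: s2; rewrite E ltnn.
move=> j ltj /andP[sj1 sj2]; have [|wn' /andP[s1' s2'] e'] := tr j ltj; first by lia.
split=> //; first by rewrite s1'.
by rewrite /setf; case: eqP => // E; move: s2'; rewrite E; lia.
Qed.

Definition optimal p : Prop :=
  exists s : 'S_n, (forall j : 'I_n, p j = s j) /\
  forall t : 'S_n, \sum_(j < n) c (s j) j <= \sum_(j < n) c (t j) j.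

(** Weak duality: feasibility bounds the cost of every permutation below by the sum of all
    potentials, and tightness makes the matching attain this bound. *)
Lemma matching_optimal u v p :
  dual_feasible u v -> matching n n u v p -> optimal p.
Proof.
move=> fe [mr mi mc mt].
have ltp (j : 'I_n) : (p j < n)%N.
  have nj : (j != n :> nat) by rewrite neq_ltn ltn_ord.
  have lej : (j <= n)%N by rewrite ltnW.
  (* If column [j] had no row, the [n] rows would all be images of the other [n - 1] columns. *)
  case: (mr j lej nj) => // pj.
  have U : uniq (map (fun j : 'I_n => nat_of_ord j) (rem j (enum 'I_n))).
    by rewrite map_inj_uniq ?rem_uniq ?enum_uniq //; apply: val_inj.
  have sub : {subset iota 0 n <= map p (map (fun j : 'I_n => nat_of_ord j) (rem j (enum 'I_n)))}.
    move=> r; rewrite mem_iota /= => ltr; have [k [lek nk pk]] := mc r ltr.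
    have ltk : (k < n)%N by rewrite ltn_neqAle nk.
    apply/mapP; exists k => //; apply/mapP; exists (Ordinal ltk) => //.
    rewrite mem_rem_uniq ?enum_uniq // !inE mem_enum andbT.
    by apply/eqP => E; move: pk; rewrite -[k]/(val (Ordinal ltk)) E pj; lia.
  have := uniq_leq_size (iota_uniq 0 n) sub.
  rewrite size_iota !size_map size_rem ?mem_enum // -cardE card_ord.
  by have := ltn_ord j; lia.
have injs : injective (fun j => Ordinal (ltp j)).
  have ok (j : 'I_n) : ((j <= n)%N * (j != n :> nat))%type.
    by rewrite neq_ltn ltn_ord ltnW.
  by move=> j k [] e; apply: val_inj; apply: mi => //; rewrite ?ok ?ltp.
have sE (j : 'I_n) : p j = perm injs j by rewrite permE.
exists (perm injs); split=> // t.
have dual (s : 'S_n) : \sum_(j < n) (u (s j) + v j) =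
    \sum_(j < n) u j + \sum_(j < n) v j.
  rewrite big_split /=; congr (_ + _).
  by rewrite [RHS](reindex_inj (@perm_inj _ s)).
have -> : \sum_(j < n) c (perm injs j) j = \sum_(j < n) (u (t j) + v j).
  rewrite dual -(dual (perm injs)); apply: eq_bigr => j _.
  have := mt j (ltn_ord j); rewrite neq_ltn ltn_ord => /(_ isT (ltp j)).
  by rewrite -sE /slack => /eqP; rewrite subr_eq add0r subr_eq => /eqP->; rewrite addrC.
apply: ler_sum => j _; have := fe (t j) j (ltn_ord _) (ltn_ord _).
by rewrite /slack; lra.
Qed.

End Hungarian.

(** * The greedy decomposition *)

Section SeqMin.
Variable R : realType.
Implicit Types s : seq R.

Lemma seq_min_mem s : s != [::] -> seq_min s \in s.
Proof.
have H (x0 : R) t : \big[Num.min/x0]_(x <- t) x \in x0 :: t.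
  elim: t => [|y t IH]; first by rewrite big_nil mem_head.
  rewrite big_cons minEle !inE; case: ifP => _; first by rewrite eqxx orbT.
  by move: IH; rewrite inE => /orP[->//|->]; rewrite !orbT.
case: s => // x s _; have := H x (x :: s); rewrite /seq_min /= !inE.
by rewrite orbA orbb.
Qed.

Lemma seq_min_le s x : x \in s -> seq_min s <= x.
Proof.
rewrite /seq_min; move: (head 0 s) => x0; elim: s => //= y s IH.
rewrite inE big_cons ge_min => /orP[/eqP->|/IH ->]; first by rewrite lexx.
by rewrite orbT.
Qed.

End SeqMin.

Section Greedy.
Variables (R : realType) (n : nat) (S A : 'M[R]_n) (f : permMx R n -> R).
Hypotheses (n_gt0 : (0 < n)%N) (S_inj : identifying S)
  (A_ge0 : forall i j, 0 <= A i j).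
Implicit Types (B : 'M[R]_n) (P Q : permMx R n).

Lemma permMxP P : exists s : 'S_n, P = perm_to_permMx R s.
Proof. by case: P => P pP; have /is_perm_mxP[s E] := pP; exists s; apply: val_inj. Qed.

Lemma perm_to_permMxE (s : 'S_n) i j :
  val (perm_to_permMx R s) i j = (s i == j)%:R.
Proof. by rewrite /= !mxE. Qed.

Lemma perm_to_permMx_eq1 (s : 'S_n) i j :
  val (perm_to_permMx R s) i j = 1 <-> s i = j.
Proof.
rewrite perm_to_permMxE; split=> [|->]; last by rewrite eqxx.
by case: eqP => // _ /eqP; rewrite eq_sym oner_eq0.
Qed.

Lemma subscalemxE B (P : 'M[R]_n) a i j : (B - a *: P) i j = B i j - a * P i j.
Proof. by rewrite !mxE. Qed.

Definition min_along B P : R :=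
  seq_min [seq B ij.1 ij.2 | ij <- enum {: 'I_n * 'I_n} & val P ij.1 ij.2 == 1].

Lemma min_along_le B P i j : val P i j = 1 -> min_along B P <= B i j.
Proof.
move=> Pij; apply: seq_min_le; apply/mapP; exists (i, j) => //.
by rewrite mem_filter /= Pij eqxx mem_enum.
Qed.

Lemma min_along_attained B P :
  exists i j, val P i j = 1 /\ min_along B P = B i j.
Proof.
have [s ->] := permMxP P; rewrite /min_along; set r := (X in seq_min X).
have r0 : r != [::].
  pose i := Ordinal n_gt0; suff : B i (s i) \in r by case: (r).
  apply/mapP; exists (i, s i) => //; rewrite mem_filter mem_enum andbT.
  by apply/eqP; apply/perm_to_permMx_eq1.
have /mapP[[i j]] := seq_min_mem r0.
by rewrite mem_filter mem_enum andbT /= => /eqP Pij E; exists i, j.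
Qed.

Definition residual l : 'M[R]_n :=
  A - \sum_(m < l) coef S A m *: val (ranked S m).

Lemma size_coefs l : size (coefs S A l) = l.
Proof. by elim: l => //= l IH; rewrite size_rcons IH. Qed.

Lemma nth_coefs m l : (m < l)%N -> (coefs S A l)`_m = coef S A m.
Proof.
elim: l => // l IH; rewrite ltnS leq_eqVlt => /predU1P[->//|ltm].
by rewrite /= nth_rcons size_coefs ltm IH.
Qed.

Lemma coefE l : coef S A l = min_along (residual l) (ranked S l).
Proof.
rewrite /coef /= nth_rcons size_coefs ltnn eqxx; congr seq_min.
apply: eq_map => -[i j] /=; rewrite /residual !mxE summxE; congr (_ - _).
by apply: eq_bigr => m _; rewrite nth_coefs // mxE.
Qed.

Lemma residualS l :
  residual l.+1 = residual l - coef S A l *: val (ranked S l).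
Proof. by rewrite /residual big_ord_recr /= opprD addrA. Qed.

Lemma residual_ge0 l i j : 0 <= residual l i j.
Proof.
elim: l i j => [|l IH] i j; first by rewrite /residual big_ord0 subr0.
rewrite residualS subscalemxE coefE; have [s Es] := permMxP (ranked S l).
have [Esi|ne] := eqVneq (s i) j.
  have P1 : val (ranked S l) i j = 1 by rewrite Es; apply/perm_to_permMx_eq1.
  by rewrite P1 mulr1 subr_ge0; apply: min_along_le.
by rewrite Es perm_to_permMxE (negPf ne) mulr0 subr0.
Qed.

Lemma coef_ge0 l : 0 <= coef S A l.
Proof.
rewrite coefE; have [i [j [_ ->]]] := min_along_attained (residual l) (ranked S l).
exact: residual_ge0.
Qed.

Lemma permMx_ge0 P i j : 0 <= val P i j.
Proof. by have [s ->] := permMxP P; rewrite perm_to_permMxE ler0n. Qed.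

Definition supported B P := forall i j, val P i j = 1 -> 0 < B i j.

(* Once processed, a permutation stays blocked, since residuals decrease. *)
Lemma processed_unsupported m l : (m < l)%N -> ~ supported (residual l) (ranked S m).
Proof.
move=> ltml; have [i [j [Pij E]]] := min_along_attained (residual m) (ranked S m).
move/(_ i j Pij); apply/negP; rewrite -leNgt.
elim: l ltml => // l IH; rewrite ltnS leq_eqVlt => /predU1P[<-|/IH {}IH].
  by rewrite residualS subscalemxE coefE Pij mulr1 E subrr.
apply: le_trans IH; rewrite residualS subscalemxE gerBl.
by rewrite mulr_ge0 ?coef_ge0 ?permMx_ge0.
Qed.

Lemma coef_unsupported l :
  ~ supported (residual l) (ranked S l) -> coef S A l = 0.
Proof.
move=> ns; apply/eqP; apply/negPn/negP => nz; apply: ns => i j Pij.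
apply: lt_le_trans (min_along_le _ Pij); rewrite -coefE lt_neqAle eq_sym nz.
exact: coef_ge0.
Qed.

(** Unsupported permutations have coefficient 0, so the residual is constant along such a block.
    This is why being unsupported need only be checked against [residual l]. *)
Lemma greedy_skip l l' :
  (l <= l')%N ->
  (forall m, (l <= m < l')%N -> ~ supported (residual l) (ranked S m)) ->
  residual l' = residual l /\
  \sum_(m < l') coef S A m * f (ranked S m) = \sum_(m < l) coef S A m * f (ranked S m).
Proof.
elim: l' => [|l' IH]; first by rewrite leqn0 => /eqP->.
rewrite leq_eqVlt => /predU1P[->//|]; rewrite ltnS => lel ns.
have [|Er Ef] := IH lel; first by move=> m /andP[lem ltm]; apply: ns; lia.
have c0 : coef S A l' = 0 by apply: coef_unsupported; rewrite Er; apply: ns; lia.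
by rewrite residualS c0 scale0r subr0 Er big_ord_recr /= c0 mul0r addr0 Ef.
Qed.

Lemma size_ranking : size (ranking S) = n`!.
Proof. by rewrite size_sort size_image card_Sn. Qed.

Lemma uniq_ranking : uniq (ranking S).
Proof.
rewrite sort_uniq map_inj_uniq ?enum_uniq // => s t [] E; apply/permP => i.
have : val (perm_to_permMx R s) i (s i) = 1 by apply/perm_to_permMx_eq1.
have -> : val (perm_to_permMx R s) = val (perm_to_permMx R t) by [].
by move/perm_to_permMx_eq1.
Qed.

Lemma ranked_surj P : exists2 l, (l < n`!)%N & ranked S l = P.
Proof.
have Pin : P \in ranking S.
  by rewrite mem_sort; have [s ->] := permMxP P; apply: image_f.
exists (index P (ranking S)); first by rewrite -size_ranking index_mem.
exact: nth_index.
Qed.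

Lemma ranked_score_lt m l :
  (m < l < n`!)%N -> score S (ranked S l) < score S (ranked S m).
Proof.
move=> /andP[ltm ltl]; have ltm' := ltn_trans ltm ltl.
rewrite lt_neqAle; apply/andP; split.
  apply/eqP => /S_inj/eqP; rewrite nth_uniq ?size_ranking ?uniq_ranking // => /eqP E.
  by move: ltm; rewrite E ltnn.
have tr : transitive (fun P Q => score S Q <= score S P).
  by move=> P Q Q' /= h1 h2; apply: le_trans h2 h1.
have so : sorted (fun P Q => score S Q <= score S P) (ranking S).
  by apply: sort_sorted => P Q; apply: le_total.
by apply: (sorted_ltn_nth tr _ so) => //; rewrite inE size_ranking.
Qed.

(** One round of the program corresponds to advancing the ranking index just past [P]. The condition
    on [P] is conditional on some permutation being supported; if none is, any [P] qualifies and the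
    round must be harmless. *)
Lemma greedy_step l P :
  (l <= n`!)%N ->
  (forall Q, supported (residual l) Q ->
     supported (residual l) P /\ score S Q <= score S P) ->
  exists2 l', (l' <= n`!)%N &
  residual l' = residual l - min_along (residual l) P *: val P /\
  \sum_(m < l') coef S A m * f (ranked S m) =
  \sum_(m < l) coef S A m * f (ranked S m) + min_along (residual l) P * f P.
Proof.
move=> lel best; set B := residual l in best *.
have [i [j [Pij E]]] := min_along_attained B P.
(* A zero minimum changes neither residual nor sum, so the index stays at [l]. *)
have := residual_ge0 l i j; rewrite -/B -E le_eqVlt => /predU1P[<-|pos].
  by exists l => //; rewrite scale0r subr0 mul0r addr0.
have sP : supported B P by move=> i' j' P'; apply: lt_le_trans pos (min_along_le _ P').
have [l0 ltl0 El0] := ranked_surj P.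
(* A supported [P] has not been processed, so its rank [l0] is at least [l]. Everything ranked
   between [l] and [l0] scores strictly higher than [P], and is therefore unsupported by [best]. *)
have lel0 : (l <= l0)%N.
  by rewrite leqNgt; apply/negP => /processed_unsupported; apply; rewrite El0.
have [] := greedy_skip lel0.
  move=> m /andP[_ ltm] /best[_]; apply/negP; rewrite -ltNge -El0.
  by apply: ranked_score_lt; rewrite ltm.
rewrite -/B => Er Ef; exists l0.+1 => //.
by rewrite residualS big_ord_recr /= Ef coefE Er El0.
Qed.

Lemma greedy_end l :
  (l <= n`!)%N -> (forall P, ~ supported (residual l) P) ->
  birkhoff_extension f S A = \sum_(m < l) coef S A m * f (ranked S m).
Proof.
move=> lel ns; have [|_ <-] := greedy_skip lel; first by [].
rewrite /birkhoff_extension big_mkcond /=; apply: eq_bigr => m _.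
by case: eqP => // ->; rewrite mul0r.
Qed.

Definition support B := [set ij : 'I_n * 'I_n | 0 < B ij.1 ij.2].

Lemma card_support_step l P :
  supported (residual l) P ->
  (#|support (residual l - min_along (residual l) P *: val P)| <
   #|support (residual l)|)%N.
Proof.
set B := residual l => sP; have [i [j [Pij E]]] := min_along_attained B P.
apply: proper_card; apply/properP; split.
  apply/subsetP => ij; rewrite !inE subscalemxE => /lt_le_trans; apply.
  by rewrite gerBl mulr_ge0 ?permMx_ge0 // E residual_ge0.
exists (i, j); first by rewrite inE sP.
by rewrite inE subscalemxE /= Pij mulr1 E subrr ltxx.
Qed.

Lemma card_support0 B P : #|support B| = 0%N -> ~ supported B P.
Proof.
move=> c0 sP; have [s Es] := permMxP P; pose i := Ordinal n_gt0.
have : (i, s i) \in support B.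
  by rewrite inE; apply: sP; rewrite Es; apply/perm_to_permMx_eq1.
by rewrite (cards0_eq c0) inE.
Qed.

End Greedy.

(* [C] penalizes entries outside the support by more than the total cost of any
   supported permutation. *)
Section Cost.
Variables (R : realType) (n : nat) (S B C : 'M[R]_n) (K : R).
Hypotheses (K_ge : forall i j, `|S i j| <= K)
  (C_def : forall i j, C i j = if B i j <= 0 then 1 + (K + K) *+ n else K - S i j).

Lemma score_perm (s : 'S_n) : score S (perm_to_permMx R s) = \sum_i S i (s i).
Proof.
apply: eq_bigr => i _; rewrite (bigD1 (s i)) //= perm_to_permMxE eqxx mulr1.
rewrite big1 ?addr0 // => j nj.
by rewrite perm_to_permMxE eq_sym (negPf nj) mulr0.
Qed.

(** Costs on the support lie between 0 and [K + K], so a supported permutation costs less than a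
    single penalty, and an optimal one cannot use a penalized entry. On supported permutations the
    cost is [n] times [K] minus the score. The inverse arises because the matching sends columns to
    rows, while a permutation matrix sends rows to columns. *)
Lemma optimal_best (s : 'S_n) :
  (forall t : 'S_n, \sum_j C (s j) j <= \sum_j C (t j) j) ->
  forall Q, supported B Q ->
    supported B (perm_to_permMx R s^-1) /\
    score S Q <= score S (perm_to_permMx R s^-1).
Proof.
move=> opt Q; have [t ->] := permMxP Q => sQ; rewrite !score_perm.
have swap (r : 'S_n) (F : 'I_n -> 'I_n -> R) : \sum_j F (r j) j = \sum_i F i (r^-1%g i).
  by rewrite [RHS](reindex_inj (@perm_inj _ r)); apply: eq_bigr => j _; rewrite permK.
have KS i j : 0 <= K - S i j <= K + K.
  by have := K_ge i j; rewrite ler_norml => /andP[]; lra.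
have C0 i j : 0 <= C i j.
  rewrite C_def; case: ifP => _; last by case/andP: (KS i j).
  have K0 := le_trans (normr_ge0 (S i j)) (K_ge i j).
  by rewrite addr_ge0 // mulrn_wge0 // addr_ge0.
have Ct : \sum_j C (t^-1%g j) j = \sum_i (K - S i (t i)).
  rewrite swap invgK; apply: eq_bigr => i _; rewrite C_def leNgt sQ //.
  exact/perm_to_permMx_eq1.
have le_opt := opt t^-1%g; rewrite Ct in le_opt.
have leW : \sum_i (K - S i (t i)) <= (K + K) *+ n.
  rewrite -[X in _ *+ X]card_ord -sumr_const; apply: ler_sum => i _.
  by case/andP: (KS i (t i)).
have sup : supported B (perm_to_permMx R s^-1).
  move=> i j /perm_to_permMx_eq1 Ej; rewrite ltNge; apply/negP => B0.
  have Ei : i = s j by rewrite -Ej permKV.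
  move: le_opt; rewrite (bigD1 j) //= -Ei C_def B0.
  have : 0 <= \sum_(k < n | k != j) C (s k) k by apply: sumr_ge0.
  lra.
split=> //; move: le_opt; rewrite swap.
rewrite (eq_bigr (fun i => K - S i (s^-1%g i))) => [|i _]; last first.
  by rewrite C_def leNgt sup //; apply/perm_to_permMx_eq1.
by rewrite !sumrB lerD2l lerN2.
Qed.

End Cost.

(** * The program *)

Local Notation zero := (NConst 0).
Local Notation one := (NConst 1).
Local Notation "# a" := (NGet a zero) (at level 1, a at level 1, format "# a").

(* Natural arrays are prefixed by [a], real ones by [r]; scalars live in cell 0.
   [aRow] holds the multiples of [n] and [aSq] its square, as the machine cannot
   multiply natural numbers. *)
Local Notation aN := 0%N.
Local Notation aSq := 1%N.
Local Notation aRow := 2%N.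
Local Notation aMatch := 3%N.
Local Notation aPar := 4%N.
Local Notation aTime := 5%N.
Local Notation aIt := 6%N.
Local Notation aI := 7%N.
Local Notation aJ := 8%N.
Local Notation aHead := 9%N.
Local Notation aNext := 10%N.
Local Notation aClock := 11%N.
Local Notation rS := 0%N.
Local Notation rB := 1%N.
Local Notation rRes := 2%N.
Local Notation rK := 3%N.
Local Notation rW := 4%N.
Local Notation rC := 5%N.
Local Notation rU := 6%N.
Local Notation rV := 7%N.
Local Notation rMin := 8%N.
Local Notation rDelta := 9%N.
Local Notation rPerm := 10%N.
Local Notation rAlpha := 11%N.
Local Notation rAns := 12%N.

Definition cell (i j : nexp) : nexp := NAdd (NGet aRow i) j.
Definition bor (b1 b2 : bexp) : bexp := BNot (BAnd (BNot b1) (BNot b2)).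
Definition unused (j : nexp) : bexp := NLe (NGet aTime j) zero.

Definition cur_slack : rexp :=
  RSub (RSub (RGet rC (cell (NGet aMatch #aHead) #aJ)) (RGet rU (NGet aMatch #aHead)))
       (RGet rV #aJ).

(** The machine has no infinite value to initialize the minima with, and the memory may hold
    anything. In the first pass, recognized by the clock, the comparison is therefore overridden and
    every minimum overwritten. *)
Definition fold_row : cmd :=
  For aJ #aN
    (If (BAnd (unused #aJ) (bor (NLe #aClock one) (RLe cur_slack (RGet rMin #aJ))))
      (Seq (RSet rMin #aJ cur_slack) (NSet aPar #aJ #aHead)) Skip).

(** The value [n] in [aNext] means that no candidate has been met yet. *)
Definition find_min : cmd :=
  Seq (NSet aNext zero #aN)
    (For aJ #aN
      (If (BAnd (unused #aJ)
            (bor (NLe #aN #aNext) (RLe (RGet rMin #aJ) (RGet rMin #aNext))))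
        (NSet aNext zero #aJ) Skip)).

(** The minimum is saved first, since the loop overwrites it at [aNext], a column still outside the
    tree. The extra iteration reaches the virtual column and so raises the potential of the row
    being inserted. *)
Definition update_dual : cmd :=
  Seq (RSet rDelta zero (RGet rMin #aNext))
    (For aJ (NAdd #aN one)
      (If (unused #aJ)
        (RSet rMin #aJ (RSub (RGet rMin #aJ) (RGet rDelta zero)))
        (Seq (RSet rU (NGet aMatch #aJ)
               (RAdd (RGet rU (NGet aMatch #aJ)) (RGet rDelta zero)))
             (RSet rV #aJ (RSub (RGet rV #aJ) (RGet rDelta zero)))))).

Definition add_column : cmd :=
  Seq (NSet aClock zero (NAdd #aClock one))
    (Seq (NSet aTime #aNext #aClock) (NSet aHead zero #aNext)).

Definition grow_tree : cmd :=
  While (NLe (NAdd (NGet aMatch #aHead) one) #aN)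
    (Seq fold_row (Seq find_min (Seq update_dual add_column))).

Definition flip_path : cmd :=
  While (NLe (NAdd #aHead one) #aN)
    (Seq (NSet aNext zero (NGet aPar #aHead))
      (Seq (NSet aMatch #aHead (NGet aMatch #aNext)) (NSet aHead zero #aNext))).

Definition insert_row : cmd :=
  Seq (Seq (NSet aMatch #aN #aI) (Seq (NSet aHead zero #aN) (NSet aClock zero one)))
    (Seq (For aJ (NAdd #aN one) (NSet aTime #aJ zero))
      (Seq (NSet aTime #aN one) (Seq grow_tree flip_path))).

Definition hungarian : cmd :=
  Seq (For aJ #aN
        (Seq (RSet rU #aJ RZero) (Seq (RSet rV #aJ RZero) (NSet aMatch #aJ #aN))))
    (For aI #aN insert_row).

(** * Scanning the columns: effect and cost of the three linear passes *)

Section HungarianSpec.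
Variables (R : realType) (o : oracle R) (n : nat).
Hypothesis n_gt0 : (0 < n)%N.
Implicit Types m : memory R.

Definition env m : Prop :=
  nmem m aN 0 = n /\ forall i, (i < n)%N -> nmem m aRow i = (i * n)%N.

Definition costs m (i j : nat) : R := rmem m rC (i * n + j)%N.

Lemma env_frame ns rs m m' :
  aN \notin ns -> aRow \notin ns -> frame ns rs m m' -> env m -> env m'.
Proof. by move=> nN nR [fn _] [e1 e2]; split; rewrite ?fn. Qed.

(** The coefficients in this and the following time bounds are rounded up generously; only the
    powers of [n] matter. *)
Lemma fold_row_spec m :
  env m -> (nmem m aMatch (nmem m aHead 0) < n)%N ->
  let s := slack (costs m) (rmem m rU) (rmem m rV)
             (nmem m aMatch (nmem m aHead 0)) in
  wp o fold_row (200 * n) (fun m' =>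
    frame [:: aPar; aJ] [:: rMin] m m' /\
    forall j, (j < n)%N ->
    if [&& nmem m aTime j == 0 & (nmem m aClock 0 <= 1) || (s j <= rmem m rMin j)%R]%N
    then nmem m' aPar j = nmem m aHead 0 /\ rmem m' rMin j = s j
    else nmem m' aPar j = nmem m aPar j /\ rmem m' rMin j = rmem m rMin j) m.
Proof.
move=> [En Er] ltp s.
pose b j := [&& nmem m aTime j == 0 & (nmem m aClock 0 <= 1) || (s j <= rmem m rMin j)%R]%N.
pose I k m' := [/\ frame [:: aPar; aJ] [:: rMin] m m', nmem m' aJ 0 = k &
  forall j, (j < n)%N -> if (j < k)%N && b j
    then nmem m' aPar j = nmem m aHead 0 /\ rmem m' rMin j = s j
    else nmem m' aPar j = nmem m aPar j /\ rmem m' rMin j = rmem m rMin j].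
apply: (@wp_for _ _ I n 120); first by rewrite /=; lia.
- by move=> k m' [[fn _] Ek _] /=; rewrite fn.
- by split=> //; frame_upd.
- move=> k m' ltk [fr Ek H].
  have [fn fr'] := fr.
  have Hk := H k ltk; rewrite ltnn /= in Hk.
  have Es : reval m' cur_slack = s k.
    rewrite /= Ek (fn aHead) // (fn aMatch) // (fn aRow) // Er //.
    by rewrite (fr' rC) // (fr' rU) // (fr' rV).
  have Eb : beval m' (BAnd (unused #aJ) (bor (NLe #aClock one)
      (RLe cur_slack (RGet rMin #aJ)))) = b k.
    rewrite -[beval _ _]/((nmem m' aTime (nmem m' aJ 0) <= 0)%N &&
      ~~ (~~ (nmem m' aClock 0 <= 1)%N &&
          ~~ (reval m' cur_slack <= rmem m' rMin (nmem m' aJ 0)))).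
    rewrite Es Ek (fn aTime) // (fn aClock) // Hk.2.
    by rewrite leqn0 negb_and !negbK.
  apply: wp_straight => //; rewrite run_if Eb /= -/(reval _ _).
  case bk: (b k) => /=.
    split=> //; split=> //; first by frame_upd.
    move=> j ltj; mem_simpl; rewrite ltnS leq_eqVlt Ek.
    case: eqP => [->|_] /=; last exact: (H j ltj).
    by rewrite bk -Es /= Ek (fn aHead).
  split=> //; split=> //; first by frame_upd.
  move=> j ltj; mem_simpl; rewrite ltnS leq_eqVlt.
  by case: eqP => [->|_] /=; [rewrite bk | apply: (H j ltj)].
- move=> m' [fr _ H]; split=> // j ltj.
  by have := H j ltj; rewrite ltj.
Qed.

Lemma find_min_spec m :
  env m -> (exists2 j, (j < n)%N & nmem m aTime j = 0%N) ->
  wp o find_min (200 * n) (fun m' =>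
    frame [:: aNext; aJ] [::] m m' /\
    [/\ (nmem m' aNext 0 < n)%N, nmem m aTime (nmem m' aNext 0) = 0%N &
      forall j, (j < n)%N -> nmem m aTime j = 0%N ->
        rmem m rMin (nmem m' aNext 0) <= rmem m rMin j]) m.
Proof.
move=> [En Er] [j1 ltj1 tj1].
apply: (@wp_seq _ _ 5 (180 * n)); first by lia.
apply: wp_straight => //; rewrite /= En.
pose I k m' := [/\ frame [:: aNext; aJ] [::] m m', nmem m' aJ 0 = k &
  let x := nmem m' aNext 0 in
  if x == n then forall j, (j < k)%N -> nmem m aTime j <> 0%N else
  [/\ (x < n)%N, nmem m aTime x = 0%N &
      forall j, (j < k)%N -> nmem m aTime j = 0%N ->
        rmem m rMin x <= rmem m rMin j]].
apply: (@wp_for _ _ I n 120); first by rewrite /=; lia.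
- by move=> k m' [[fn _] Ek _] /=; rewrite fn.
- split=> //; first by frame_upd.
  by mem_simpl; rewrite eqxx.
- move=> k m' ltk [fr Ek H]; have [fn fr'] := fr; move: H; set x := nmem m' aNext 0 => /= H.
  have lex : (x <= n)%N by case: eqP H => [->|_ []] //; lia.
  apply: wp_straight => //=; rewrite Ek (fn aTime) // (fn aN) // En (fr' rMin) // -/x.
  rewrite leqn0 negb_and !negbK; case: ifP => /= [/andP[/eqP tk cond]|cond].
    split=> //; split=> //; first by frame_upd.
    mem_simpl; rewrite (ltn_eqF ltk); split=> // j; rewrite ltnS leq_eqVlt.
    case/predU1P=> [->//|ltj tj]; move: H cond; case: (eqVneq x n) => [_ /(_ j ltj)//|nx].
    have -> /= : (n <= x)%N = false by lia.
    by move=> [_ _ M] le; apply: le_trans le (M j ltj tj).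
  split=> //; split=> //; first by frame_upd.
  mem_simpl; rewrite -/x; move: H cond; case: (eqVneq x n) => [-> H|nx [ltx tx M]].
    rewrite leqnn andbT => /eqP tk j; rewrite ltnS leq_eqVlt => /predU1P[->//|].
    exact: H.
  have -> /= : (n <= x)%N = false by lia.
  move=> cond; split=> // j; rewrite ltnS leq_eqVlt => /predU1P[->|]; last exact: M.
  move=> tk; move: cond; rewrite tk eqxx /= => /negbT.
  by rewrite -ltNge => /ltW.
- move=> m' [fr _ H]; split=> //; move: H => /=; case: eqP => // _ /(_ j1 ltj1).
  by rewrite tj1.
Qed.

(** The loop runs over columns but updates the potentials of rows. Injectivity on tree columns
    ensures that no row is raised twice. *)
Lemma update_dual_spec m :
  env m ->
  (forall j k, (j <= n)%N -> (k <= n)%N -> (0 < nmem m aTime j)%N -> (0 < nmem m aTime k)%N ->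
     nmem m aMatch j = nmem m aMatch k -> j = k) ->
  let d := rmem m rMin (nmem m aNext 0) in
  wp o update_dual (500 * n) (fun m' =>
    [/\ frame [:: aJ] [:: rDelta; rMin; rU; rV] m m',
      forall r, rmem m' rU r = rmem m rU r +
        if usedrow (nmem m aMatch) (nmem m aTime) n.+1 r then d else 0,
      forall j, (j < n)%N -> rmem m' rV j = rmem m rV j -
        if (0 < nmem m aTime j)%N then d else 0 &
      forall j, (j < n)%N -> nmem m aTime j = 0%N -> rmem m' rMin j = rmem m rMin j - d]) m.
Proof.
move=> [En Er] inj d.
apply: (@wp_seq _ _ 10 (480 * n)); first by lia.
apply: wp_straight => //; rewrite /= -/d.
pose I k m' := [/\ frame [:: aJ] [:: rDelta; rMin; rU; rV] m m' /\ nmem m' aJ 0 = k,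
  rmem m' rDelta 0 = d,
  forall r, rmem m' rU r = rmem m rU r +
        if usedrow (nmem m aMatch) (nmem m aTime) k r then d else 0,
  forall j, (j < n)%N -> rmem m' rV j = rmem m rV j -
        if (j < k)%N && (0 < nmem m aTime j)%N then d else 0 &
  forall j, rmem m' rMin j = rmem m rMin j -
     if (j < k)%N && (nmem m aTime j == 0%N) then d else 0].
apply: (@wp_for _ _ I n.+1 120); first by rewrite /=; lia.
- by move=> k m' [[[fn _] Ek] _ _ _ _] /=; rewrite fn // En addn1.
- split=> //.
  + by split=> //; frame_upd.
  + by move=> r; rewrite addr0.
  + by move=> j _; rewrite subr0.
  + by move=> j; rewrite subr0.
- move=> k m' ltk [[fr Ek] Ed HU HV HM]; have [fn fr'] := fr.
  have us r : usedrow (nmem m aMatch) (nmem m aTime) k.+1 r =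
      usedrow (nmem m aMatch) (nmem m aTime) k r
      || ((0 < nmem m aTime k)%N && (nmem m aMatch k == r)).
    by rewrite /usedrow -[k.+1]addn1 iotaD has_cat /= add0n orbF.
  apply: wp_straight => //=; rewrite Ek (fn aTime) // (fn aMatch) // leqn0.
  case: ifP => /= [/eqP tk|tk].
    split=> //; split=> //.
    + by split=> //; frame_upd.
    + by move=> r; mem_simpl; rewrite us tk orbF HU.
    + move=> j ltj; mem_simpl; rewrite HV // ltnS_eqVlt.
      by case: eqP => [->|//]; rewrite tk ltnn.
    + move=> j; mem_simpl; rewrite ltnS_eqVlt.
      case: eqP => [->|_]; last by rewrite HM.
      by rewrite HM ltnn subr0 tk eqxx Ed.
  have tk0 : (0 < nmem m aTime k)%N by rewrite lt0n tk.
  split=> //; split=> //.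
  + by split=> //; frame_upd.
  + move=> r; mem_simpl; rewrite us tk0 /= eq_sym.
    case: eqP => [Ekr|_]; last by rewrite orbF HU.
    rewrite Ekr HU orbT ifF ?addr0 ?Ed //.
    apply/negbTE/hasPn => j; rewrite mem_iota /= => ltj; apply/andP => -[tj /eqP E].
    have := inj j k _ _ tj tk0 (etrans E (esym Ekr)); lia.
  + move=> j ltj; mem_simpl; rewrite ltnS_eqVlt.
    case: eqP => [E|_]; last by rewrite HV.
    by rewrite E in ltj *; rewrite HV // ltnn subr0 tk0 Ed.
  + move=> j; mem_simpl; rewrite HM ltnS_eqVlt.
    by case: (eqVneq j k) => [->|//]; rewrite tk !andbF.
- move=> m' [[fr _] _ HU HV HM]; split=> //.
  + by move=> j ltj; rewrite HV // ltnS ltnW.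
  + by move=> j ltj tj; rewrite HM tj eqxx ltnS ltnW.
Qed.

End HungarianSpec.

(** * Growing the tree, flipping the path, inserting all rows *)

Section HungarianLoops.
Variables (R : realType) (o : oracle R) (n : nat).
Hypothesis n_gt0 : (0 < n)%N.
Implicit Types m : memory R.

Definition growing i m : Prop :=
  grow n (costs n m) i (nmem m aClock 0) (nmem m aHead 0) (rmem m rU) (rmem m rV)
    (nmem m aMatch) (nmem m aTime) (nmem m aPar) (rmem m rMin).

Lemma costs_frame ns rs m m' : rC \notin rs -> frame ns rs m m' -> costs n m' = costs n m.
Proof. by move=> nC [_ fr]; rewrite /costs fr. Qed.

Lemma grow_body_spec i m :
  env n m -> (i < n)%N -> growing i m -> (nmem m aMatch (nmem m aHead 0) < n)%N ->
  wp o (Seq fold_row (Seq find_min (Seq update_dual add_column))) (1000 * n) (fun m' =>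
    [/\ frame [:: aPar; aTime; aJ; aHead; aNext; aClock] [:: rU; rV; rMin; rDelta] m m',
        growing i m' & nmem m' aClock 0 = (nmem m aClock 0).+1]) m.
Proof.
move=> e lti g p0.
have e0 := e; case: (e) => En _.
apply: (@wp_seq _ _ (200 * n) (750 * n)); first by lia.
apply: (wp_post (fold_row_spec o n_gt0 e p0)) => m1 [fr1 H1].
have [g1 F1] := grow_fold g H1.
have [fn1 fm1] := fr1.
have e1 : env n m1 by apply: env_frame fr1 e.
have [j' ltj' tj'] := grow_unused g lti p0.
apply: (@wp_seq _ _ (200 * n) (540 * n)); first by lia.
have uu : exists2 j, (j < n)%N & nmem m1 aTime j = 0%N by exists j'; rewrite // fn1.
apply: (wp_post (find_min_spec o n_gt0 e1 uu)) => m2 [fr2 [lt2 t2 M2]].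
have [fn2 fm2] := fr2.
have e2 : env n m2 by apply: env_frame fr2 e1.
rewrite (fn1 aTime) // in t2 M2.
apply: (@wp_seq _ _ (500 * n) 30); first by lia.
have inj j k : (j <= n)%N -> (k <= n)%N -> (0 < nmem m2 aTime j)%N ->
    (0 < nmem m2 aTime k)%N -> nmem m2 aMatch j = nmem m2 aMatch k -> j = k.
  rewrite !fn2 // !fn1 // => lej lek tj tk E.
  apply: (m_inj (g_match g)) => //; try lia.
  exact: grow_row_lt g lti p0 lej tj.
apply: (wp_post (update_dual_spec o n_gt0 e2 inj)) => m3 [fr3 HU HV HM].
have [fn3 fm3] := fr3.
set j1 := nmem m2 aNext 0 in lt2 t2 M2 HU HV HM *.
have Ej1 : nmem m3 aNext 0 = j1 by rewrite fn3.
have Ek : nmem m3 aClock 0 = nmem m aClock 0 by rewrite fn3 // fn2 // fn1.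
rewrite !(fn2 aTime) // !(fn2 aMatch) // !(fm2 rU) // !(fm2 rV) // !(fm2 rMin) // in HU HV HM.
rewrite !(fn1 aTime) // !(fn1 aMatch) // !(fm1 rU) // !(fm1 rV) // in HU HV HM.
have G := grow_step g1 F1 lti p0 lt2 t2 (erefl _) M2 HU HV HM.
apply: wp_straight => //=; split; last by mem_simpl; rewrite Ek addn1.
  frame_upd; apply: frame_trans (frame_sub _ _ fr1) _ => //.
  by apply: frame_trans (frame_sub _ _ fr2) (frame_sub _ _ fr3).
rewrite /growing; mem_simpl.
rewrite (_ : costs n _ = costs n m); last first.
  by rewrite /costs /= fm3 // fm2 // fm1.
rewrite Ej1 Ek addn1 (fn3 aMatch) // (fn2 aMatch) // (fn1 aMatch) //.
by rewrite (fn3 aTime) // (fn2 aTime) // (fn1 aTime) // (fn3 aPar) // (fn2 aPar).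
Qed.

(** The clock exceeds the number of real columns in the tree by one and so never passes [n.+1],
    which leaves at most [n] growth steps of linear cost. *)
Lemma grow_tree_spec i m :
  env n m -> (i < n)%N -> growing i m ->
  wp o grow_tree (1100 * n * n) (fun m' =>
    [/\ frame [:: aPar; aTime; aJ; aHead; aNext; aClock] [:: rU; rV; rMin; rDelta] m m',
        growing i m' & nmem m' aMatch (nmem m' aHead 0) = n]) m.
Proof.
move=> e lti g; have [En _] := e.
pose I d m' := [/\ frame [:: aPar; aTime; aJ; aHead; aNext; aClock]
    [:: rU; rV; rMin; rDelta] m m', growing i m' & d = (n.+1 - nmem m' aClock 0)%N].
apply: (@wp_while _ _ I (n.+1 - nmem m aClock 0)%N (1000 * n)).
- have := g_pos g; rewrite /=; nia.
- by [].
- move=> d m' [fr g' Ed] /=; have e' : env n m' by apply: env_frame fr e.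
  case: (e') => -> _ H; split=> //.
  case: (m_range (g_match g') (proj1 (g_last g'))) => //; first by have := proj1 (g_last g'); lia.
  lia.
- move=> d m' [fr g' Ed] /=; have e' : env n m' by apply: env_frame fr e.
  case: (e') => -> _; rewrite addn1 => p0.
  apply: (wp_post (grow_body_spec e' lti g' p0)) => m2 [fr2 g2 E2].
  exists (n.+1 - nmem m2 aClock 0)%N; first by have := grow_bound g2; lia.
  by split=> //; apply: frame_trans fr fr2.
Qed.

(** The entry time of the hole serves as the variant, since parents entered earlier. The walk can
    only stop at the virtual column, where hole [n] is again the state between insertions. *)
Lemma flip_path_spec i m :
  env n m -> (nmem m aTime (nmem m aHead 0) <= n.+1)%N ->
  augment n (costs n m) i (nmem m aHead 0) (rmem m rU) (rmem m rV)
    (nmem m aMatch) (nmem m aTime) (nmem m aPar) ->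
  wp o flip_path (200 * n) (fun m' =>
    frame [:: aMatch; aHead; aNext] [::] m m' /\
    matching n (costs n m) i n (rmem m rU) (rmem m rV) (nmem m' aMatch)) m.
Proof.
move=> e le0 a; have [En _] := e.
pose I d m' := [/\ frame [:: aMatch; aHead; aNext] [::] m m',
  augment n (costs n m) i (nmem m' aHead 0) (rmem m rU) (rmem m rV)
    (nmem m' aMatch) (nmem m aTime) (nmem m aPar) & d = nmem m aTime (nmem m' aHead 0)].
apply: (@wp_while _ _ I (nmem m aTime (nmem m aHead 0)) 50).
- rewrite /=; nia.
- by [].
- move=> d m' [fr a' _] /=; have [En' _] : env n m' by apply: env_frame fr e.
  rewrite En' => H; split=> //; have [leh _] := a_hole a'.
  have Eh : nmem m' aHead 0 = n by lia.
  by have := a_match a'; rewrite Eh.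
- move=> d m' [fr a' Ed] /=; have [En' _] : env n m' by apply: env_frame fr e.
  rewrite En' addn1 => lth; have [a2 lt2] := augment_step a' lth.
  have [fn _] := fr.
  apply: wp_straight => //=; exists (nmem m aTime (nmem m aPar (nmem m' aHead 0))).
    by rewrite Ed.
  split.
  + by frame_upd.
  + by mem_simpl; rewrite (fn aPar).
  + by mem_simpl; rewrite (fn aPar).
Qed.

Definition partial_solution i m : Prop :=
  dual_feasible n (costs n m) (rmem m rU) (rmem m rV) /\
  matching n (costs n m) i n (rmem m rU) (rmem m rV) (nmem m aMatch).

Lemma insert_row_spec m :
  env n m -> (nmem m aI 0 < n)%N -> partial_solution (nmem m aI 0) m ->
  wp o insert_row (2000 * n * n) (fun m' =>
    frame [:: aMatch; aPar; aTime; aJ; aHead; aNext; aClock]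
      [:: rU; rV; rMin; rDelta] m m' /\ partial_solution (nmem m aI 0).+1 m') m.
Proof.
set i := nmem m aI 0 => e lti [fe mp]; have [En Er] := e.
set ns := [:: _; _; _; _; _; _; _]; set rs := [:: _; _; _; _].
apply: (@wp_seq _ _ 30 (1900 * n * n)); first by nia.
apply: wp_straight => //=; rewrite En -/i.
set m1 := Memory _ _.
have e1 : env n m1 by [].
have fr1 : frame ns rs m m1 by frame_upd.
have [En1 Er1] := e1.
apply: (@wp_seq _ _ (100 * n) (1700 * n * n)); first by nia.
pose I k m' := [/\ frame [:: aTime; aJ] [::] m1 m', nmem m' aJ 0 = k &
  forall j, (j < k)%N -> nmem m' aTime j = 0%N].
apply: (@wp_for _ _ I n.+1 10); first by rewrite /=; lia.
- by move=> k m' [[fn _] Ek _] /=; rewrite fn // En1 addn1.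
- by split=> //; frame_upd.
- move=> k m' ltk [fr Ek H]; apply: wp_straight => //=; rewrite Ek; split=> //.
  split=> //; first by frame_upd.
  move=> j; mem_simpl; rewrite ltnS leq_eqVlt; case: eqP => //= _; exact: H.
move=> m2 [fr2 _ T2]; have [fn2 fm2] := fr2.
apply: (@wp_seq _ _ 10 (1600 * n * n)); first by nia.
apply: wp_straight => //=; rewrite (fn2 aN) // En1.
set m3 := Memory _ _.
have fr3 : frame ns rs m m3.
  apply: frame_trans fr1 _.
  by apply: frame_updn => //; apply: frame_sub fr2.
have e3 : env n m3 by apply: env_frame fr3 e.
have cE := costs_frame _ fr3.
have g3 : growing i m3.
  rewrite /growing cE // /m3; mem_simpl.
  rewrite (fn2 aClock) // (fn2 aHead) // (fn2 aMatch) // (fm2 rU) // (fm2 rV) // /m1; mem_simpl.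
  rewrite En -/(setf (nmem m aMatch) n i); apply: grow_init => //; first by move=> j ltj; rewrite (ltn_eqF ltj) T2 // leqW.
  by rewrite eqxx.
apply: (@wp_seq _ _ (1100 * n * n) (200 * n)); first by nia.
apply: (wp_post (grow_tree_spec e3 lti g3)) => m4 [fr4 g4 p4].
have e4 : env n m4 by apply: env_frame fr4 e3.
have le4 : (nmem m4 aTime (nmem m4 aHead 0) <= n.+1)%N.
  by rewrite (proj2 (g_last g4)); apply: grow_bound g4.
apply: (wp_post (flip_path_spec e4 le4 (augment_init lti g4 p4))) => m5 [fr5 mp5].
split.
  apply: frame_trans fr3 _.
  by apply: frame_trans (frame_sub _ _ fr4) (frame_sub _ _ fr5).
by rewrite /partial_solution (costs_frame _ fr5) // !(proj2 fr5) //; split=> //; apply: g_feas g4.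
Qed.

(** Nonnegative costs make the zero potentials feasible at the start. *)
Lemma hungarian_spec m :
  env n m -> (forall i j, (i < n)%N -> (j < n)%N -> 0 <= costs n m i j) ->
  wp o hungarian (3000 * n ^ 3) (fun m' =>
    frame [:: aMatch; aPar; aTime; aI; aJ; aHead; aNext; aClock]
      [:: rU; rV; rMin; rDelta] m m' /\ optimal n (costs n m) (nmem m' aMatch)) m.
Proof.
move=> e C0; have [En Er] := e.
apply: (@wp_seq _ _ (200 * n) (2700 * n ^ 3)); first by rewrite !expnS; nia.
set ns := [:: _; _; _; _; _; _; _; _]; set rs := [:: _; _; _; _].
pose I k m' := [/\ frame [:: aMatch; aJ] [:: rU; rV] m m', nmem m' aJ 0 = k &
  forall j, (j < k)%N -> [/\ rmem m' rU j = 0, rmem m' rV j = 0 & nmem m' aMatch j = n]].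
apply: (@wp_for _ _ I n 50); first by rewrite /=; lia.
- by move=> k m' [[fn _] Ek _] /=; rewrite fn.
- by split=> //; frame_upd.
- move=> k m' ltk [fr Ek H]; apply: wp_straight => //=; rewrite Ek; split=> //.
  split=> //; first by frame_upd.
  move=> j; mem_simpl; rewrite (proj1 fr aN) // En ltnS leq_eqVlt.
  by case: eqP => //= _; apply: H.
move=> m1 [fr1 _ H1].
have e1 : env n m1 by apply: env_frame fr1 e.
pose J k m' := [/\ frame ns rs m m', nmem m' aI 0 = k & partial_solution k m'].
apply: (@wp_for _ _ J n (2000 * n * n)).
- rewrite /= !expnS expn0; nia.
- by move=> k m' [[fn _] Ek _] /=; rewrite fn.
- split=> //; first by frame_upd; apply: frame_sub fr1.
  have c1 : costs n (setx aI 0 m1) = costs n m by rewrite /costs /= (proj2 fr1).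
  rewrite /partial_solution c1 /=; split.
    move=> i j lti ltj; rewrite /slack; have [-> _ _] := H1 i lti.
    by have [_ -> _] := H1 j ltj; rewrite !subr0 C0.
  have M j : (j <= n)%N -> j != n -> nmem m1 aMatch j = n.
    by move=> lej nj; have [|_ _ ->//] := H1 j; rewrite ltn_neqAle nj.
  rewrite /upd /=; split=> //.
  + by move=> j lej nj; right; apply: M.
  + by move=> j k lej lek nj nk; rewrite M // ltnn.
  + by move=> j ltj nj; rewrite M ?ltnn // ltnW.
- move=> k m' ltk [fr Ek ps]; have e' : env n m' by apply: env_frame fr e.
  rewrite -Ek in ltk ps.
  apply: (wp_post (insert_row_spec e' ltk ps)) => m2 [fr2 ps2].
  rewrite (proj1 fr2 aI) //; split=> //; split=> //; last by rewrite -Ek.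
  by frame_upd; apply: frame_trans fr (frame_sub _ _ fr2).
- move=> m' [fr _ [fe mp]]; split=> //.
  by rewrite -(costs_frame _ fr) //; apply: matching_optimal fe mp.
Qed.

End HungarianLoops.

Definition build_cost : cmd :=
  For aJ #aSq
    (If (RLe (RGet rB #aJ) RZero) (RSet rC #aJ (RGet rW zero))
      (RSet rC #aJ (RSub (RGet rK zero) (RGet rS #aJ)))).

Definition matched_cell (j : nexp) : nexp := cell (NGet aMatch j) j.

Definition write_perm : cmd :=
  Seq (For aJ #aSq (RSet rPerm #aJ RZero))
    (For aJ #aN (RSet rPerm (matched_cell #aJ) ROne)).

Definition get_min : cmd :=
  Seq (RSet rAlpha zero (RGet rB (matched_cell zero)))
    (For aJ #aN
      (If (RLe (RGet rB (matched_cell #aJ)) (RGet rAlpha zero))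
        (RSet rAlpha zero (RGet rB (matched_cell #aJ))) Skip)).

Definition subtract : cmd :=
  For aJ #aN
    (RSet rB (matched_cell #aJ) (RSub (RGet rB (matched_cell #aJ)) (RGet rAlpha zero))).

Definition round : cmd :=
  Seq build_cost (Seq hungarian (Seq write_perm (Seq get_min
    (Seq (Ask rAns zero rPerm)
      (Seq (RSet rRes zero (RAdd (RGet rRes zero) (RMul (RGet rAlpha zero) (RGet rAns zero))))
        subtract))))).

(** Multiples of [n] are accumulated by addition up to row [n], which yields the square. As
    [1 + s^2] is nonnegative and bounds [|s|], its sum over all entries bounds each of them without
    any comparison. The penalty starts at 1, which makes it strictly larger than [n] times
    [K + K]. *)
Definition setup : cmd :=
  Seq (NSet aRow zero zero)
    (Seq (For aJ #aN (NSet aRow (NAdd #aJ one) (NAdd (NGet aRow #aJ) #aN)))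
    (Seq (Seq (NSet aSq zero (NGet aRow #aN))
           (Seq (RSet rK zero RZero) (Seq (RSet rW zero ROne) (RSet rRes zero RZero))))
    (Seq (For aJ #aSq (RSet rK zero (RAdd (RGet rK zero)
           (RAdd ROne (RMul (RGet rS #aJ) (RGet rS #aJ))))))
      (For aJ #aN (RSet rW zero (RAdd (RGet rW zero)
           (RAdd (RGet rK zero) (RGet rK zero)))))))).

(* Every round kills an entry of the residual, unless no permutation is
   supported any more, in which case it has no effect: [n * n] rounds suffice
   and no test for termination is needed. *)
Definition program : cmd := Seq setup (For aIt #aSq round).

(** * One round of the decomposition *)

Section Round.
Variables (R : realType) (n : nat) (f : permMx R n -> R) (S : 'M[R]_n).
Hypothesis n_gt0 : (0 < n)%N.
Implicit Types m : memory R.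

Local Notation o := (oracle_of f).

Lemma cell_lt i j : (i < n)%N -> (j < n)%N -> (i * n + j < n * n)%N.
Proof. nia. Qed.

Lemma cell_eq i j i' j' : (j < n)%N -> (j' < n)%N ->
  (i * n + j == i' * n + j')%N = (j == j') && (i == i').
Proof.
move=> ltj ltj'; apply/eqP/andP => [E|[/eqP-> /eqP->]//].
have := congr1 (modn^~ n) E; rewrite !modnMDl !modn_small // => Ej.
by move: E; rewrite Ej => /eqP; rewrite eqxx eqn_add2r eqn_pmul2r.
Qed.

Record static m : Prop := Static {
  s_env : env n m;
  s_sq : nmem m aSq 0 = (n * n)%N;
  s_S : read_mx n (rmem m rS) = S;
  s_K : forall i j, `|S i j| <= rmem m rK 0;
  s_W : rmem m rW 0 = 1 + (rmem m rK 0 + rmem m rK 0) *+ n }.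

Lemma static_frame ns rs m m' :
  [&& aN \notin ns, aRow \notin ns & aSq \notin ns] ->
  [&& rS \notin rs, rK \notin rs & rW \notin rs] ->
  frame ns rs m m' -> static m -> static m'.
Proof.
case/and3P=> n1 n2 n3 /and3P[r1 r2 r3] fr [e sq sS sK sW].
have [fn fm] := fr; split.
- exact: env_frame n1 n2 fr e.
- by rewrite fn.
- by rewrite fm.
- by rewrite fm.
- by rewrite !fm.
Qed.

Lemma build_cost_spec m :
  static m ->
  wp o build_cost (200 * n * n) (fun m' => frame [:: aJ] [:: rC] m m' /\
    forall x, (x < n * n)%N -> rmem m' rC x =
      if rmem m rB x <= 0 then rmem m rW 0 else rmem m rK 0 - rmem m rS x) m.
Proof.
move=> st; have Esq := s_sq st.
pose I k m' := [/\ frame [:: aJ] [:: rC] m m', nmem m' aJ 0 = k &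
  forall x, (x < k)%N -> rmem m' rC x =
      if rmem m rB x <= 0 then rmem m rW 0 else rmem m rK 0 - rmem m rS x].
apply: (@wp_for _ _ I (n * n) 50).
- rewrite /=; nia.
- by move=> k m' [[fn _] Ek _] /=; rewrite fn.
- by split=> //; frame_upd.
- move=> k m' ltk [fr Ek H]; have [fn fm] := fr.
  apply: wp_straight => //; rewrite run_if /= Ek (fm rB) // (fm rW) // (fm rK) // (fm rS) //.
  have [c|c] := boolP (rmem m rB k <= 0); split=> //; split=> //; try by frame_upd.
  + move=> x; mem_simpl; rewrite ltnS_eqVlt; case: eqP => [->|_ /=]; first by rewrite c.
    exact: H.
  + move=> x; mem_simpl; rewrite ltnS_eqVlt.
    by case: eqP => [->|_ /=]; [rewrite (negPf c) | apply: H].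
- by move=> m' [fr _ H].
Qed.

Definition matches m (s : 'S_n) : Prop :=
  env n m /\ forall j : 'I_n, nmem m aMatch j = s j.

Lemma matches_frame ns rs m m' s :
  [&& aN \notin ns, aRow \notin ns & aMatch \notin ns] ->
  frame ns rs m m' -> matches m s -> matches m' s.
Proof.
case/and3P=> n1 n2 n3 fr [e H]; split; first exact: env_frame n1 n2 fr e.
by move=> j; rewrite (proj1 fr).
Qed.

Lemma matched_cellE m s e (j : 'I_n) :
  matches m s -> neval m e = j -> neval m (matched_cell e) = (s j * n + j)%N.
Proof. by move=> [[_ Er] H] /= ->; rewrite H Er. Qed.

Lemma write_perm_spec m s :
  matches m s -> nmem m aSq 0 = (n * n)%N ->
  wp o write_perm (200 * n * n) (fun m' => frame [:: aJ] [:: rPerm] m m' /\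
    read_mx n (rmem m' rPerm) = val (perm_to_permMx R s^-1)) m.
Proof.
move=> mt Esq.
apply: (@wp_seq _ _ (100 * n * n) (90 * n)); first by nia.
pose I k m' := [/\ frame [:: aJ] [:: rPerm] m m', nmem m' aJ 0 = k &
  forall x, (x < k)%N -> rmem m' rPerm x = 0].
apply: (@wp_for _ _ I (n * n) 20).
- rewrite /=; nia.
- by move=> k m' [[fn _] Ek _] /=; rewrite fn.
- by split=> //; frame_upd.
- move=> k m' ltk [fr Ek H]; apply: wp_straight => //=; rewrite Ek; split=> //.
  split=> //; first by frame_upd.
  by move=> x; mem_simpl; rewrite ltnS_eqVlt; case: eqP => //= _; apply: H.
move=> m1 [fr1 _ H1].
pose J k m' := [/\ frame [:: aJ] [:: rPerm] m m', nmem m' aJ 0 = k &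
  forall i j : 'I_n, rmem m' rPerm (i * n + j)%N = ((j < k)%N && (i == s j))%:R].
apply: (@wp_for _ _ J n 30); first by rewrite /=; lia.
- by move=> k m' [[fn _] Ek _] /=; rewrite fn //; case: mt => -[].
- split=> //; first by frame_upd.
  by move=> i j; mem_simpl; rewrite H1 // cell_lt.
- move=> k m' ltk [fr Ek H]; have mt' : matches m' s by apply: matches_frame fr mt.
  have Ec := matched_cellE (e := #aJ) (j := Ordinal ltk) mt' Ek.
  apply: wp_straight => //; rewrite -[run _ _]/(Memory (nmem m')
    (upd (rmem m') rPerm (neval m' (matched_cell #aJ)) 1)) Ec /=.
  split=> //; split=> //; first by frame_upd.
  move=> i j; mem_simpl; rewrite cell_eq // H ltnS_eqVlt.
  case: (eqVneq (j : nat) k) => [Ej|_] //=.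
  have -> : Ordinal ltk = j by apply: val_inj.
  have [->|ne] := eqVneq i (s j); first by rewrite !eqxx.
  by rewrite andbF ifN.
- move=> m' [fr _ H]; split=> //; apply/matrixP => i j.
  rewrite mxE H ltn_ord perm_to_permMxE /=; congr (nat_of_bool _)%:R.
  by apply/eqP/eqP => [->|<-]; rewrite ?permK ?permKV.
Qed.

Lemma get_min_spec m s :
  matches m s ->
  wp o get_min (200 * n) (fun m' => frame [:: aJ] [:: rAlpha] m m' /\
    rmem m' rAlpha 0 =
      min_along (read_mx n (rmem m rB)) (perm_to_permMx R s^-1)) m.
Proof.
move=> mt; pose b (j : 'I_n) := rmem m rB (s j * n + j)%N.
apply: (@wp_seq _ _ 15 (180 * n)); first by lia.
have E0 := matched_cellE (e := zero) (j := Ordinal n_gt0) mt erefl.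
apply: wp_straight => //; rewrite -[run _ _]/(Memory (nmem m)
    (upd (rmem m) rAlpha 0 (rmem m rB (neval m (matched_cell zero))))) E0.
pose I k m' := [/\ frame [:: aJ] [:: rAlpha] m m', nmem m' aJ 0 = k,
  exists j, rmem m' rAlpha 0 = b j &
  forall j : 'I_n, (j < k)%N -> rmem m' rAlpha 0 <= b j].
apply: (@wp_for _ _ I n 50); first by rewrite /=; lia.
- by move=> k m' [[fn _] Ek _] /=; rewrite fn //; case: mt => -[].
- by split=> //; [frame_upd | exists (Ordinal n_gt0)].
- move=> k m' ltk [fr Ek ex H]; have mt' : matches m' s by apply: matches_frame fr mt.
  have Ec := matched_cellE (e := #aJ) (j := Ordinal ltk) mt' Ek.
  have Eb : rmem m' rB (neval m' (matched_cell #aJ)) = b (Ordinal ltk).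
    by rewrite Ec (proj2 fr).
  apply: wp_straight => //; rewrite run_if.
  rewrite -[beval _ _]/(rmem m' rB (neval m' (matched_cell #aJ)) <= rmem m' rAlpha 0).
  rewrite -[run (RSet _ _ _) _]/(Memory (nmem m') (upd (rmem m') rAlpha 0
    (rmem m' rB (neval m' (matched_cell #aJ))))) Eb -[run Skip _]/m'.
  have split_lt (j : 'I_n) : (j < k.+1)%N -> j = Ordinal ltk \/ (j < k)%N.
    by rewrite ltnS_eqVlt => /predU1P[E|]; [left; apply: val_inj | right].
  case: ifP => c; split=> //; split=> //; try by frame_upd.
  + by exists (Ordinal ltk).
  + by move=> j /split_lt[->|/H] //; mem_simpl; apply: le_trans.
  + move=> j /split_lt[->|/H] //; mem_simpl.
    by rewrite ltW // ltNge c.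
- move=> m' [fr _ [j0 E] H]; split=> //; apply/le_anti/andP; split.
    have [i [j [/perm_to_permMx_eq1 Pij ->]]] :=
      min_along_attained n_gt0 (read_mx n (rmem m rB)) (perm_to_permMx R s^-1).
    by rewrite mxE -[i](permKV s) Pij; apply: H.
  have P1 : val (perm_to_permMx R s^-1) (s j0) j0 = 1.
    by apply/perm_to_permMx_eq1; rewrite permK.
  by apply: le_trans (min_along_le _ P1) _; rewrite E mxE.
Qed.

Lemma subtract_spec m s :
  matches m s ->
  wp o subtract (200 * n) (fun m' => frame [:: aJ] [:: rB] m m' /\
    read_mx n (rmem m' rB) = read_mx n (rmem m rB)
      - rmem m rAlpha 0 *: val (perm_to_permMx R s^-1)) m.
Proof.
move=> mt.
pose J k m' := [/\ frame [:: aJ] [:: rB] m m', nmem m' aJ 0 = k &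
  forall i j : 'I_n, rmem m' rB (i * n + j)%N = rmem m rB (i * n + j)%N -
    rmem m rAlpha 0 * ((j < k)%N && (i == s j))%:R].
apply: (@wp_for _ _ J n 50); first by rewrite /=; lia.
- by move=> k m' [[fn _] Ek _] /=; rewrite fn //; case: mt => -[].
- split=> //; first by frame_upd.
  by move=> i j; mem_simpl; rewrite mulr0 subr0.
- move=> k m' ltk [fr Ek H]; have mt' : matches m' s by apply: matches_frame fr mt.
  have Ec := matched_cellE (e := #aJ) (j := Ordinal ltk) mt' Ek.
  apply: wp_straight => //; rewrite -[run _ _]/(Memory (nmem m')
    (upd (rmem m') rB (neval m' (matched_cell #aJ))
      (rmem m' rB (neval m' (matched_cell #aJ)) - rmem m' rAlpha 0))) Ec.
  split=> //; split=> //; first by frame_upd.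
  move=> i j; mem_simpl; rewrite cell_eq // ltnS_eqVlt.
  case: (eqVneq (j : nat) k) => [Ej|_] /=; last by rewrite H.
  have Ej' : Ordinal ltk = j by apply: val_inj.
  rewrite -[k]/(val (Ordinal ltk)) Ej' val_eqE (proj2 fr rAlpha) //.
  have [Ei|ne] := eqVneq i (s j); last first.
    by rewrite H (negPf ne) andbF.
  by rewrite -Ei H Ej ltnn /= mulr0 subr0 mulr1.
- move=> m' [fr _ H]; split=> //; apply/matrixP => i j.
  rewrite subscalemxE perm_to_permMxE !mxE H ltn_ord /=; congr (_ - _ * (nat_of_bool _)%:R).
  by apply/eqP/eqP => [->|<-]; rewrite ?permK ?permKV.
Qed.

Lemma round_spec m :
  static m ->
  let B := read_mx n (rmem m rB) in
  wp o round (4000 * n ^ 3) (fun m' =>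
    frame [:: aMatch; aPar; aTime; aI; aJ; aHead; aNext; aClock]
      [:: rB; rRes; rC; rU; rV; rMin; rDelta; rPerm; rAlpha; rAns] m m' /\
    exists P, [/\ forall Q, supported B Q -> supported B P /\ score S Q <= score S P,
      read_mx n (rmem m' rB) = B - min_along B P *: val P &
      rmem m' rRes 0 = rmem m rRes 0 + min_along B P * f P]) m.
Proof.
move=> st B; set ns := [:: _; _; _; _; _; _; _; _].
set rs := [:: _; _; _; _; _; _; _; _; _; _].
have e := s_env st.
have Sx (i j : 'I_n) : rmem m rS (i * n + j)%N = S i j by rewrite -(s_S st) mxE.
apply: (@wp_seq _ _ (200 * n * n) (3790 * n ^ 3)); first by rewrite !expnS; nia.
apply: (wp_post (build_cost_spec st)) => m1 [fr1 H1].
have e1 : env n m1 by apply: env_frame fr1 e.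
have Cij (i j : 'I_n) : costs n m1 i j =
    if B i j <= 0 then 1 + (rmem m rK 0 + rmem m rK 0) *+ n else rmem m rK 0 - S i j.
  by rewrite /costs H1 ?cell_lt // -(s_W st) -Sx mxE.
have C0 i j : (i < n)%N -> (j < n)%N -> 0 <= costs n m1 i j.
  move=> lti ltj; rewrite (Cij (Ordinal lti) (Ordinal ltj)).
  have := s_K st (Ordinal lti) (Ordinal ltj); set K := rmem m rK 0; rewrite ler_norml => /andP[k1 k2].
  case: ifP => _; last by rewrite subr_ge0.
  have K0 : 0 <= K by lra.
  by rewrite addr_ge0 // mulrn_wge0 // addr_ge0.
apply: (@wp_seq _ _ (3000 * n ^ 3) (750 * n ^ 3)); first by rewrite !expnS; nia.
apply: (wp_post (hungarian_spec o n_gt0 e1 C0)) => m2 [fr2 [s [Hs opt]]].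
have CE (i j : 'I_n) : read_mx n (rmem m1 rC) i j =
    if B i j <= 0 then 1 + (rmem m rK 0 + rmem m rK 0) *+ n else rmem m rK 0 - S i j.
  by rewrite mxE; apply: Cij.
have optC (t : 'S_n) : \sum_j read_mx n (rmem m1 rC) (s j) j <=
    \sum_j read_mx n (rmem m1 rC) (t j) j.
  rewrite (eq_bigr (fun j => costs n m1 (s j) j)) => [|j _]; last by rewrite mxE.
  by rewrite [leRHS](eq_bigr (fun j => costs n m1 (t j) j)) => [|j _]; rewrite ?mxE.
have best := optimal_best (s_K st) CE optC.
set P := perm_to_permMx R s^-1 in best *.
have fr12 : frame ns rs m m2.
  by apply: frame_trans (frame_sub _ _ fr1) (frame_sub _ _ fr2).
have mt2 : matches m2 s by split=> //; apply: env_frame fr12 e.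
have sq2 : nmem m2 aSq 0 = (n * n)%N by rewrite (proj1 fr12) // (s_sq st).
have B2 : read_mx n (rmem m2 rB) = B by rewrite (proj2 fr2) // (proj2 fr1).
apply: (@wp_seq _ _ (200 * n * n) (540 * n ^ 3)); first by rewrite !expnS; nia.
apply: (wp_post (write_perm_spec mt2 sq2)) => m3 [fr3 P3].
have mt3 : matches m3 s by apply: matches_frame fr3 mt2.
have B3 : read_mx n (rmem m3 rB) = B by rewrite (proj2 fr3).
apply: (@wp_seq _ _ (200 * n) (330 * n ^ 3)); first by rewrite !expnS; nia.
apply: (wp_post (get_min_spec mt3)) => m4 [fr4]; rewrite B3 -/P => Ea.
have mt4 : matches m4 s by apply: matches_frame fr4 mt3.
have B4 : read_mx n (rmem m4 rB) = B by rewrite (proj2 fr4).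
apply: (@wp_seq _ _ 5 (320 * n ^ 3)); first by rewrite !expnS; nia.
(* The oracle accepts the query even if [P] is unsupported: an optimal assignment is a permutation
   in any case. *)
apply: (@wp_ask _ _ _ _ _ _ _ _ (f P)) => //.
  by rewrite /oracle_of (proj2 fr4) // P3 valK.
apply: (@wp_seq _ _ 15 (200 * n)); first by rewrite !expnS; nia.
apply: wp_straight => //=.
set m5 := Memory _ _.
have fr5 : frame ns rs m4 m5 by frame_upd.
have mt5 : matches m5 s by [].
have Ea5 : rmem m5 rAlpha 0 = min_along B P by rewrite -Ea.
have B5 : read_mx n (rmem m5 rB) = B by rewrite -B4.
apply: (wp_post (subtract_spec mt5)) => m6 [fr6].
rewrite B5 Ea5 -/P => E6.
split.
  apply: frame_trans fr12 _; apply: frame_trans (frame_sub _ _ fr3) _ => //.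
  apply: frame_trans (frame_sub _ _ fr4) _ => //.
  exact: frame_trans fr5 (frame_sub _ _ fr6).
exists P; split=> //.
rewrite (proj2 fr6) // /m5; mem_simpl.
by rewrite Ea (proj2 fr4) // (proj2 fr3) // (proj2 fr2) // (proj2 fr1).
Qed.

End Round.

(** * Preprocessing and the loop over all rounds *)

Section Main.
Variables (R : realType) (n : nat) (f : permMx R n -> R) (S : 'M[R]_n).
Hypothesis n_gt0 : (0 < n)%N.
Implicit Types m : memory R.

Local Notation o := (oracle_of f).

Lemma setup_spec m :
  nmem m aN 0 = n -> read_mx n (rmem m rS) = S ->
  wp o setup (500 * n * n) (fun m' => [/\ static S m',
    rmem m' rB = rmem m rB & rmem m' rRes 0 = 0]) m.
Proof.
move=> En ES.
apply: (@wp_seq _ _ 5 (490 * n * n)); first by nia.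
apply: wp_straight => //=.
apply: (@wp_seq _ _ (100 * n) (380 * n * n)); first by nia.
pose I k m' := [/\ frame [:: aRow; aJ] [::] m m', nmem m' aJ 0 = k &
  forall i, (i <= k)%N -> nmem m' aRow i = (i * n)%N].
apply: (@wp_for _ _ I n 30); first by rewrite /=; lia.
- by move=> k m' [[fn _] Ek _] /=; rewrite fn.
- split=> //; first by frame_upd.
  by move=> i; rewrite leqn0 => /eqP->.
- move=> k m' ltk [fr Ek H]; apply: wp_straight => //=; rewrite Ek (proj1 fr aN) // En.
  split=> //; split=> //; first by frame_upd.
  move=> i; mem_simpl; rewrite leq_eqVlt addn1 H //.
  by case: eqP => [->|_ /= /H//]; rewrite mulSnr.
move=> m1 [fr1 _ H1]; have [fn1 fm1] := fr1.
apply: (@wp_seq _ _ 20 (350 * n * n)); first by nia.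
apply: wp_straight => //=; rewrite (fn1 aN) // En H1 //.
set m2 := Memory _ _.
have fr2 : frame [:: aSq; aRow; aJ] [:: rK; rW; rRes] m m2.
  by frame_upd; apply: frame_sub fr1.
have N2 : nmem m2 aN 0 = n by rewrite (proj1 fr2).
have S2 : nmem m2 aSq 0 = (n * n)%N by [].
have W2 : rmem m2 rW 0 = 1 by [].
have K2 : rmem m2 rK 0 = 0 by [].
have R2 : rmem m2 rRes 0 = 0 by [].
have Ro2 i : (i < n)%N -> nmem m2 aRow i = (i * n)%N by move=> /ltnW; apply: H1.
clearbody m2.
apply: (@wp_seq _ _ (150 * n * n) (150 * n)); first by nia.
pose J k m' := [/\ frame [:: aJ] [:: rK] m2 m', nmem m' aJ 0 = k, 0 <= rmem m' rK 0 &
  forall x, (x < k)%N -> `|rmem m rS x| <= rmem m' rK 0].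
apply: (@wp_for _ _ J (n * n) 30).
- rewrite /=; nia.
- by move=> k m' [[fn _] Ek _ _] /=; rewrite fn.
- by split=> //; [frame_upd | rewrite /= K2].
- move=> k m' ltk [fr Ek K0 H]; apply: wp_straight => //=; rewrite Ek (proj2 fr rS) // (proj2 fr2 rS) //.
  set s := rmem m rS k; have s2 : 0 <= s * s by rewrite -expr2 sqr_ge0.
  split=> //; split=> //; first by frame_upd.
    by mem_simpl; rewrite !addr_ge0.
  move=> x; mem_simpl; rewrite ltnS_eqVlt => /predU1P[->|/H]; last by lra.
  (* The squares of [s + 1] and [s - 1] give [|s| <= 1 + s^2]. *)
  have h1 : 0 <= s * s + s + s + 1.
    have -> : s * s + s + s + 1 = (s + 1) ^+ 2 by ring.
    exact: sqr_ge0.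
  have h2 : 0 <= s * s - s - s + 1.
    have -> : s * s - s - s + 1 = (s - 1) ^+ 2 by ring.
    exact: sqr_ge0.
  by rewrite -/s ler_norml; apply/andP; split; lra.
move=> m3 [fr3 _ K3 H3]; set K := rmem m3 rK 0 in K3 H3.
have W3 : rmem m3 rW 0 = 1 by rewrite (proj2 fr3).
pose L k m' := [/\ frame [:: aJ] [:: rW] m3 m', nmem m' aJ 0 = k &
  rmem m' rW 0 = 1 + (K + K) *+ k].
apply: (@wp_for _ _ L n 30); first by rewrite /=; lia.
- by move=> k m' [[fn _] Ek _] /=; rewrite fn // (proj1 fr3).
- by split=> //; [frame_upd | rewrite /= W3 addr0].
- move=> k m' ltk [fr Ek H]; apply: wp_straight => //=; rewrite (proj2 fr rK) // -/K H.
  split=> //; split=> //; first by frame_upd.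
  by mem_simpl; rewrite mulrSr [RHS]addrA.
move=> m' [[fn fm] _ W]; have [fn3 fm3] := fr3; have [fn2 fm2] := fr2.
split.
- split.
  + by split=> [|i lti]; rewrite fn // fn3 // Ro2.
  + by rewrite fn // fn3.
  + by rewrite fm // fm3 // fm2.
  + by move=> i j; rewrite -ES mxE fm //; apply: H3; apply: cell_lt.
  + by rewrite W fm.
- by rewrite fm // fm3 // fm2.
- by rewrite fm // fm3.
Qed.

Lemma program_spec (A : 'M[R]_n) m :
  identifying S -> (forall i j, 0 <= A i j) ->
  nmem m aN 0 = n -> read_mx n (rmem m rS) = S -> read_mx n (rmem m rB) = A ->
  wp o program (4900 * n ^ 5) (fun m' => rmem m' rRes 0 = birkhoff_extension f S A) m.
Proof.
move=> S_inj A0 En ES EA.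
have [n1 n3] : (n * n <= n ^ 5)%N /\ (n * n * n ^ 3 = n ^ 5)%N.
  have n3 : (n * n * n ^ 3 = n ^ 5)%N by rewrite mulnn -expnD.
  by split=> //; rewrite -n3 leq_pmulr // expn_gt0 n_gt0.
have n5 : (0 < n ^ 5)%N by rewrite expn_gt0 n_gt0.
apply: (@wp_seq _ _ (500 * n * n) (4200 * n ^ 5)); first by rewrite -mulnA; lia.
apply: (wp_post (setup_spec En ES)) => m1 [st1 B1 R1].
rewrite -B1 in EA.
(* The ghost index [l] is the place in the ranking reached after [k] rounds. The last clause counts
   progress: either [k] entries at least are missing from the support, or no permutation is
   supported and the remaining rounds are idle. *)
pose I k m' := [/\ nmem m' aIt 0 = k, static S m' &
  exists l, [/\ (l <= n`!)%N, read_mx n (rmem m' rB) = residual S A l,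
   rmem m' rRes 0 = \sum_(i < l) coef S A i * f (ranked S i) &
   (k + #|support (residual S A l)| <= n * n)%N \/
   forall P, ~ supported (residual S A l) P]].
apply: (@wp_for _ _ I (n * n) (4000 * n ^ 3)).
- rewrite /=; lia.
- by move=> k m' [Ek st _]; rewrite /= (s_sq st).
- split=> //; first apply: (static_frame (ns := [:: aIt]) (rs := [::]) _ _ _ st1) => //.
    by frame_upd.
  exists 0%N; split=> //; first by rewrite /= EA /residual big_ord0 subr0.
    by rewrite /= R1 big_ord0.
  by left; rewrite add0n; apply: leq_trans (max_card _) _; rewrite card_prod card_ord.
- move=> k m' ltk [Ek st [l [lel EB ER pr]]].
  apply: (wp_post (round_spec f n_gt0 st)); rewrite EB => m2 [fr2 [P [best EB2 ER2]]].
  rewrite (proj1 fr2) //; split=> //; split=> //.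
    apply: (static_frame (ns := [:: aMatch; aPar; aTime; aI; aJ; aHead; aNext; aClock; aIt])
      _ _ _ st); last by frame_upd; apply: frame_sub fr2.
    - by [].
    - by [].
  have [l' lel' [Er Ef]] := greedy_step f n_gt0 S_inj A0 lel best.
  exists l'; split=> //=; first by rewrite EB2 Er.
    by rewrite ER2 ER Ef.
  have [i [j [Pij E]]] := min_along_attained n_gt0 (residual S A l) P.
  (* If the minimum along [P] vanishes, [P] is unsupported, and then by [best] so is every
     permutation. *)
  have [z|nz] := eqVneq (min_along (residual S A l) P) 0.
    right=> Q; rewrite Er z scale0r subr0 => /best[sP _].
    by have := sP i j Pij; rewrite -E z ltxx.
  have sP : supported (residual S A l) P.
    move=> i' j' P'; apply: lt_le_trans (min_along_le _ P').
    by rewrite lt_neqAle eq_sym nz E residual_ge0.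
  case: pr => [le|/(_ P)//]; left; rewrite Er.
  apply: leq_trans le; rewrite addSn -addnS leq_add2l.
  exact: card_support_step.
move=> m' [_ _ [l [lel _ -> pr]]]; apply/esym; apply: greedy_end => //.
(* After [n * n] rounds the count forces an empty support, so both cases leave no supported
   permutation. *)
case: pr => // le P; apply: card_support0 => //; lia.
Qed.

End Main.

Theorem mainTheorem5 (R : realType) :
  exists (c : cmd) (C : nat),
    forall (n : nat) (f : permMx R n -> R) (S A : 'M[R]_n),
      (0 < n)%N -> identifying S -> doubly_stochastic A ->
      computes_within c f S A (C * n ^ 5)%N (birkhoff_extension f S A).
Proof.
exists program, 4900%N => n f S A n_gt0 S_inj [A0 _ _] m En ES EA.
by have [t [m' H]] := program_spec f n_gt0 S_inj A0 En ES EA; exists t, m'.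
Qed.
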